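(* Let $\gamma>0$, $\mu\ge 0$ and $W\in C^3(\mathbb R,[0,\infty))$. Let $(u,v)$ be a strong solution on $S^1\times(0,\infty)$ of $$\partial_t u-\partial_x v=0,\qquad \partial_t v-\partial_x W'(u)=\mu\,\partial_{xx}v-\gamma\,\partial_{xxx}u,$$ and let $(\widehat u,\widehat v)$ be a strong solution on $S^1\times(0,\infty)$ of the perturbed problem $$\partial_t \widehat u-\partial_x \widehat v=0,\qquad \partial_t \widehat v-\partial_x W'(\widehat u)=\mu\,\partial_{xx}\widehat v-\gamma\,\partial_{xxx}\widehat u+\mathfrak R,$$ where $\mathfrak R$ is some residual. Assume $\widehat u(\cdot,0)=u(\cdot,0)$, $\widehat v(\cdot,0)=v(\cdot,0)$ and $$\overline M:=\max\left(\|u\|_{L^\infty(S^1\times(0,\infty))},\|\widehat u\|_{L^\infty(S^1\times(0,\infty))}\right)<\infty .$$ Define the reduced relative entropy $$\eta_R(t):=\frac12\int_{S^1}\Big[(v(\cdot,t)-\widehat v(\cdot,t))^2+\gamma\,(\partial_xu(\cdot,t)-\partial_x\widehat u(\cdot,t))^2\Big]dx+\frac{\mu}{4}\int_0^t|v(\cdot,s)-\widehat v(\cdot,s)|_{H^1(S^1)}^2\,ds .$$ Then for all $t$ $$\eta_R(t)\le\Big(\eta_R(0)+\|\mathfrak R\|^2_{L^2(S^1\times(0,t))}\Big)\exp\left(\int_0^tK[\widehat u](s)\,ds\right),$$ where $$K[\widehat u](t):=\max\left(\frac{2C_P^2\overline W^2}{\gamma}\|\partial_x\widehat u(\cdot,t)\|_{L^\infty(S^1)}^2+\frac{2\overline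 W^2}{\gamma},\ \frac32\right),\qquad \overline W:=\|W\|_{C^3([-\overline M,\overline M])},$$ and $C_P$ is a Poincaré constant.
   Context: $S^1$ denotes the unit interval $[0,1]$ with endpoints identified (periodic boundary conditions). $|\cdot|_{H^1(S^1)}$ is the seminorm $|w|_{H^1(S^1)}=\|\partial_xw\|_{L^2(S^1)}$. A strong solution is a pair such that for every $T>0$ the first component is in $C^0([0,T];H^3(S^1))\cap C^1([0,T];H^1(S^1))$, the second in $C^0([0,T];H^2(S^1))\cap C^1([0,T];L^2(S^1))$, and the equations hold in $L^2(S^1)$ for each time. $\|W\|_{C^3(I)}$ is the usual norm $\max_{0\le k\le3}\sup_I|W^{(k)}|$. $C_P$ is a constant with $\|w\|_{L^2(S^1)}\le C_P\|\partial_xw\|_{L^2(S^1)}$ for all $w\in H^1(S^1)$ with $\int_{S^1}w=0$. *)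

(* Defs.v *)
From HB Require Import structures.
From mathcomp Require Import all_boot all_order all_algebra.
From mathcomp Require Import all_classical all_reals all_analysis.

Set Implicit Arguments.
Unset Strict Implicit.
Unset Printing Implicit Defensive.

Import Order.TTheory GRing.Theory Num.Theory.
Import numFieldNormedType.Exports.

Local Open Scope classical_set_scope.
Local Open Scope ring_scope.
Local Open Scope ereal_scope.

(* S^1 is [0,1] with endpoints identified.  A (class of) function(s) on S^1 is
   represented by any w : R -> R, of which only the values on S1 matter, and
   only up to null sets; periodicity enters through the test functions.  A
   function of time with values in such classes is u : R -> R -> R, where
   u t x stands for u(x,t).  Norms and integrals are extended-real, so that no
   default value is ever taken for an infinite quantity. *)

Notation leb := lebesgue_measure.

Section sobolev.
Context {R : realType}.

Definition S1 : set R := `[0%R, 1%R].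

Definition normS1 (p : \bar R) (w : R -> R) : \bar R :=
  'N[leb]_p[(EFin \o w) \_ S1].

(* L^p(S^1 x I) norm; the space variable is the first component *)
Definition normS1x (I : set R) (p : \bar R) (u : R -> R -> R) : \bar R :=
  'N[leb \x leb]_p[(fun z : R * R => (u z.2 z.1)%:E) \_ (S1 `*` I)].

(* Classes of functions on S^1 x I have to be represented by jointly measurable
   functions; measurability of each u t alone would not suffice for normS1x. *)
Definition measurableS1x (I : set R) (u : R -> R -> R) : Prop :=
  measurable_fun (S1 `*` I) (fun z : R * R => u z.2 z.1).

Definition L2 (w : R -> R) : Prop :=
  measurable_fun S1 w /\ normS1 2%:E w < +oo.

Definition test_function (phi : R -> R) : Prop :=
  (forall n x, derivable (derive1n n phi) x 1) /\ (forall x, phi (x + 1)%R = phi x).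

Definition is_wderiv (k : nat) (w g : R -> R) : Prop :=
  [/\ leb.-integrable S1 (EFin \o w), leb.-integrable S1 (EFin \o g) &
      forall phi, test_function phi ->
        (\int[leb]_(x in S1) (w x * derive1n k phi x) =
         (-1) ^+ k * \int[leb]_(x in S1) (g x * phi x))%R].

(* a chosen representative of the k-th weak derivative, which is unique up to
   null sets; meaningful only when the weak derivative exists *)
Definition wderiv (k : nat) (w : R -> R) : R -> R :=
  xget (fun=> 0%R) [set g | is_wderiv k w g].

Definition Hk (k : nat) (w : R -> R) : Prop :=
  L2 w /\
  forall j, (j <= k)%N -> exists2 g, is_wderiv j w g & L2 g.

Definition normHk (k : nat) (w : R -> R) : \bar R :=
  sqrte (\sum_(j < k.+1) normS1 2%:E (wderiv j w) ^+ 2).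

Definition seminormH1 (w : R -> R) : \bar R := normS1 2%:E (wderiv 1 w).

Definition C0_Hk (T : R) (k : nat) (u : R -> R -> R) : Prop :=
  forall t, (0 <= t <= T)%R ->
    Hk k (u t) /\
    normHk k (fun x => u s x - u t x)%R @[s --> within `[0%R, T] (nbhs t)]
      --> 0.

(* u is in C^1([0,T];H^k) with time derivative ut *)
Definition is_C1_Hk (T : R) (k : nat) (u ut : R -> R -> R) : Prop :=
  [/\ C0_Hk T k u, C0_Hk T k ut &
      forall t, (0 <= t <= T)%R ->
        normHk k (fun x => (u s x - u t x) / (s - t) - ut t x)%R
          @[s --> within `[0%R, T] t^'] --> 0].

(* The second equation holding in L^2 includes the existence of the weak
   derivative of W'(u) in L^2; Res = 0 gives the unperturbed system. *)
Definition strong_solution (W : R -> R) (gamma mu : R) (Res u v : R -> R -> R)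
    : Prop :=
  exists ut vt : R -> R -> R,
    [/\ forall T : R, (0 < T)%R -> C0_Hk T 3 u /\ is_C1_Hk T 1 u ut,
        forall T : R, (0 < T)%R -> C0_Hk T 2 v /\ is_C1_Hk T 0 v vt,
        forall t : R, (0 < t)%R ->
          ae_eq leb S1 (ut t) (wderiv 1 (v t)) &
        forall t : R, (0 < t)%R ->
          Hk 1 (fun x => derive1 W (u t x)) /\
          ae_eq leb S1
            (fun x => vt t x - wderiv 1 (fun y => derive1 W (u t y)) x)%R
            (fun x => mu * wderiv 2 (v t) x - gamma * wderiv 3 (u t) x
                      + Res t x)%R].

Definition class_C3 (W : R -> R) : Prop :=
  (forall k x, (k < 3)%N -> derivable (derive1n k W) x 1) /\ continuous (derive1n 3 W).

Definition normC3 (W : R -> R) (M : R) : R :=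
  \big[Num.max/0%R]_(k < 4)
    sup [set `|derive1n k W x|%R | x in `[(- M)%R, M]].

Definition poincare_constant (CP : R) : Prop :=
  forall w, Hk 1 w -> (\int[leb]_(x in S1) w x = 0)%R ->
    normS1 2%:E w <= CP%:E * seminormH1 w.

Definition Mbar (u uh : R -> R -> R) : \bar R :=
  maxe (normS1x `]0%R, +oo[ +oo u) (normS1x `]0%R, +oo[ +oo uh).

Definition Wbar (W : R -> R) (u uh : R -> R -> R) : R :=
  normC3 W (fine (Mbar u uh)).

Definition etaR (gamma mu : R) (u v uh vh : R -> R -> R) (t : R) : \bar R :=
  2^-1%:E *
    \int[leb]_(x in S1)
      ((v t x - vh t x) ^+ 2
       + gamma * (wderiv 1 (u t) x - wderiv 1 (uh t) x) ^+ 2)%:E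
  + (mu / 4)%:E *
    \int[leb]_(s in `[0%R, t]) seminormH1 (fun x => v s x - vh s x)%R ^+ 2.

Definition K (gamma CP Wb : R) (uh : R -> R -> R) (t : R) : \bar R :=
  maxe ((2 * CP ^+ 2 * Wb ^+ 2 / gamma)%:E
          * normS1 +oo (wderiv 1 (uh t)) ^+ 2
        + (2 * Wb ^+ 2 / gamma)%:E)
       (3 / 2)%:E.

End sobolev.

(* Main.v *)
Require Import Defs.
From HB Require Import structures.
From mathcomp Require Import all_boot all_order all_algebra.
From mathcomp Require Import all_classical all_reals all_analysis.
From mathcomp Require Import measurable_realfun ess_sup_inf.
From mathcomp Require Import ring lra.
Set Implicit Arguments.
Unset Strict Implicit.
Unset Printing Implicit Defensive.
Import Order.TTheory GRing.Theory Num.Theory.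
Import numFieldNormedType.Exports.
Local Open Scope classical_set_scope.
Local Open Scope ring_scope.

(** The estimate is a relative energy argument.  Put e = u - uh and f = v - vh,
and let y be half of |f|^2 + gamma |e_x|^2.  In dy/dt the dispersive terms
gamma <f_x, e_xx> and - gamma <e_xx, f_x> cancel, the first because f is tested
against - gamma e_xxx, the second because e_t = f_x; this leaves

  dy/dt + mu |f_x|^2 = <f, (W'(u) - W'(uh))_x> - <f, Res>     (energy_rate).

The stress difference is W''(u) e_x + (W''(u) - W''(uh)) uh_x.  As u and uh are
a.e. bounded by Mbar, its L^2 norm is controlled, through Wbar, by |e_x| and
|uh_x|_oo |e|; since e_t = f_x has mean zero and e vanishes initially, e has
mean zero at all times (mean_zero), so the Poincare inequality replaces |e| by
C_P |e_x| (stress_bound).  Young's inequality with weight 1/2 on the stress and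
weight 1/4 on the residual uses up 3/4 |f|^2, that is 3/2 times |f|^2 / 2, which
is where the constant 3/2 in K comes from, and gives d eta_R/dt <= K eta_R +
|Res|^2.  Gronwall's lemma concludes (gronwall); it needs no regularity of
|Res|^2 in time besides measurability, because exp (- int K) eta_R is C^1.

What makes these computations legitimate is the theory of weak derivatives on
the circle.  Everything there rests on one representation: w has weak derivative
g exactly when g has mean zero and w is a.e. a constant plus the primitive of g
(wderiv1_prim, wderiv1_int0, wderiv1_repr).  It follows from the fundamental lemma of the calculus of
variations, for which explicit periodic smooth functions approximating
indicators of intervals are built, and from integration by parts for
primitives, which is Fubini's theorem on a triangle.  The representation yields
integration by parts between weakly differentiable functions (ip_by_parts), the
embedding of H^1 in L^oo (sobolev_sup) and the chain rule for W'(u)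
(wderiv1_comp).  The embedding also makes K continuous in time, so that its
integral is finite. *)

(** * Integrals and the L^2 inner product on the circle *)

Section S1_integral.
Context {R : realType}.
Implicit Types (f g h w : R -> R).
Local Notation leb := (@lebesgue_measure R).

Definition intS1 w : R := (\int[leb]_(x in S1) w x)%R.
Definition integrable_S1 w : Prop := leb.-integrable S1 (EFin \o w).
Definition ip f g : R := intS1 (fun x => f x * g x).

(** The Lebesgue measure lives on measurableTypeR R, whose display differs from
the one inferred for R although both are the Borel sets; fixing the carrier
here keeps the two from being mixed. *)
Definition meas_S1 w : Prop :=
  measurable_fun (S1 : set (measurableTypeR R)) w.

Lemma measurable_S1 : measurable (S1 : set (measurableTypeR R)).
Proof. exact: measurable_itv. Qed.
Local Hint Resolve measurable_S1 : core.

Lemma leb_S1 : leb (S1 : set (measurableTypeR R)) = 1%E.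
Proof. by rewrite /S1 lebesgue_measure_itv/= lte_fin ltr01 oppr0 adde0. Qed.

(** Instances of filterS and filterS2 for Lebesgue-almost every point, stated
with the filter fixed so that it need not be inferred. *)
Lemma ae_imp (P Q : R -> Prop) : (forall x, P x -> Q x) ->
  (\forall x \ae leb, P x) -> \forall x \ae leb, Q x.
Proof. by move=> PQ; apply: filterS; first exact: (ae_filter_ringOfSetsType leb). Qed.

Lemma ae_imp2 (P Q S : R -> Prop) : (forall x, P x -> Q x -> S x) ->
  (\forall x \ae leb, P x) -> (\forall x \ae leb, Q x) ->
  \forall x \ae leb, S x.
Proof. by move=> PQ; apply: filterS2; first exact: (ae_filter_ringOfSetsType leb). Qed.

Lemma integrable_S1_measurable w : integrable_S1 w -> meas_S1 w.
Proof. by move=> /measurable_int/measurable_EFinP. Qed.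

Lemma integrable_S1_cst (c : R) : integrable_S1 (fun=> c).
Proof.
apply: measurable_bounded_integrable => //; first by rewrite [X in (X < _)%E]leb_S1 ltry.
by exists `|c|; split => // M cM x _ /=; rewrite ltW.
Qed.

Lemma integrable_S1D f g : integrable_S1 f -> integrable_S1 g ->
  integrable_S1 (fun x => f x + g x).
Proof. by move=> fi gi; have := integrableD measurable_S1 fi gi. Qed.

Lemma integrable_S1Z (a : R) f : integrable_S1 f -> integrable_S1 (fun x => a * f x).
Proof. by move=> fi; have := integrableZl measurable_S1 a fi. Qed.

Lemma integrable_S1B f g : integrable_S1 f -> integrable_S1 g ->
  integrable_S1 (fun x => f x - g x).
Proof. by move=> fi gi; have := integrableB measurable_S1 fi gi. Qed.

Lemma le_integrable_S1 f g : meas_S1 f ->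
  (forall x, S1 x -> `|f x| <= g x) -> integrable_S1 g -> integrable_S1 f.
Proof.
move=> mf fg; apply: le_integrable => //; first exact/measurable_EFinP.
by move=> x /fg fgx /=; rewrite lee_fin (le_trans fgx)// ler_norm.
Qed.

Lemma intS1D f g : integrable_S1 f -> integrable_S1 g ->
  intS1 (fun x => f x + g x) = intS1 f + intS1 g.
Proof. by move=> *; exact: RintegralD. Qed.

Lemma intS1B f g : integrable_S1 f -> integrable_S1 g ->
  intS1 (fun x => f x - g x) = intS1 f - intS1 g.
Proof. by move=> *; exact: RintegralB. Qed.

Lemma intS1Z (a : R) f : integrable_S1 f -> intS1 (fun x => a * f x) = a * intS1 f.
Proof. by move=> *; exact: RintegralZl. Qed.

Lemma intS1_cst (c : R) : intS1 (fun=> c) = c.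
Proof. by rewrite /intS1 Rintegral_cst// (_ : fine _ = 1) ?mulr1// [X in fine X]leb_S1. Qed.

Lemma intS1_ge0 f : (forall x, 0 <= f x) -> 0 <= intS1 f.
Proof. by move=> f0; apply: Rintegral_ge0 => x _. Qed.

Lemma eq_intS1 f g : (forall x, S1 x -> f x = g x) -> intS1 f = intS1 g.
Proof. by move=> fg; apply: eq_Rintegral => x /set_mem; exact: fg. Qed.

Lemma ae_eq_intS1 f g : meas_S1 f -> meas_S1 g ->
  ae_eq leb S1 f g -> intS1 f = intS1 g.
Proof.
move=> mf mg fg; congr fine; apply: ae_eq_integral => //; try exact/measurable_EFinP.
exact: (ae_eq_comp EFin fg).
Qed.

Lemma le_intS1 f g : integrable_S1 f -> integrable_S1 g ->
  (\forall x \ae leb, S1 x -> f x <= g x) -> intS1 f <= intS1 g.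
Proof.
move=> fi gi fg; have mf := integrable_S1_measurable fi.
have mg := integrable_S1_measurable gi.
have mm : integrable_S1 (fun x => Num.max (f x) (g x)).
  apply: (@le_integrable_S1 _ (fun x => `|f x| + `|g x|)).
  - exact: measurable_maxr.
  - move=> x _; case: (leP (f x) (g x)) => _; by rewrite ?lerDl ?lerDr.
  - by apply: integrable_S1D; exact: integrable_norm.
rewrite (@ae_eq_intS1 g (fun x => Num.max (f x) (g x)))//.
- by apply: le_Rintegral => // x _; rewrite le_max lexx.
- exact: integrable_S1_measurable.
- by apply: (ae_imp _ fg) => x /[apply]; case: leP.
Qed.

Lemma EFin_intS1 f : integrable_S1 f ->
  (\int[leb]_(x in S1) (f x)%:E)%E = (intS1 f)%:E.
Proof. by move=> fi; rewrite /intS1 /Rintegral fineK//; exact: integrable_fin_num. Qed.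

(** Valid for every w, measurable or not, since both sides are the same
extended-real integral. *)
Lemma normS1_sqr w :
  (normS1 2%:E w ^+ 2 = \int[leb]_(x in S1) ((w x) ^+ 2)%:E)%E.
Proof.
rewrite /normS1 unlock poweR12_sqrt; last by apply: integral_ge0 => x _; exact: poweR_ge0.
rewrite sqr_sqrte; last by apply: integral_ge0 => x _; exact: poweR_ge0.
rewrite [RHS]integral_mkcond; apply: eq_integral => x _.
rewrite !patchE; case: ifPn => _ /=; last by rewrite normr0 powR0.
by rewrite powR_mulrn// real_normK// num_real.
Qed.

Lemma L2P w : L2 w <-> meas_S1 w /\ integrable_S1 (fun x => w x ^+ 2).
Proof.
have sq0 : (0 <= \int[leb]_(x in S1) ((w x) ^+ 2)%:E)%E.
  by apply: integral_ge0 => x _; rewrite lee_fin sqr_ge0.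
have N0 : (0 <= normS1 2%:E w)%E by exact: Lnorm_ge0.
split=> -[mw].
  move=> Nfin; split => //; apply/integrableP; split; first exact/measurable_EFinP/measurable_funX.
  under eq_integral do rewrite /= ger0_norm ?sqr_ge0//.
  rewrite -normS1_sqr expe2; move: Nfin N0; case: (normS1 _ w) => // r _ _.
  exact: ltry.
move=> /integrableP[_]; under eq_integral do rewrite /= ger0_norm ?sqr_ge0//.
rewrite -normS1_sqr => h; split => //; move: h N0.
by case: (normS1 _ w) => // r _ _; rewrite ltry.
Qed.

Lemma L2_measurable w : L2 w -> meas_S1 w. Proof. by case. Qed.

Lemma L2_sqr w : L2 w -> integrable_S1 (fun x => w x ^+ 2).
Proof. by move=> /L2P[]. Qed.

Lemma L2_mul f g : L2 f -> L2 g -> integrable_S1 (fun x => f x * g x).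
Proof.
move=> /L2P[mf fi] /L2P[mg gi].
apply: (@le_integrable_S1 _ (fun x => f x ^+ 2 + g x ^+ 2)).
- exact: measurable_funM.
- move=> x _; rewrite normrM -(real_normK (num_real (f x))).
  rewrite -(real_normK (num_real (g x))).
  have := sqr_ge0 (`|f x| - `|g x|); rewrite sqrrB.
  have := mulr_ge0 (normr_ge0 (f x)) (normr_ge0 (g x)).
  set a := `|f x|; set b := `|g x|; lra.
- exact: integrable_S1D.
Qed.

Lemma L2_cst (c : R) : L2 (fun=> c).
Proof.
apply/L2P; split; first exact: measurable_cst.
exact: (integrable_S1_cst (c ^+ 2)).
Qed.

Lemma L2_integrable f : L2 f -> integrable_S1 f.
Proof.
move=> Lf; have := L2_mul Lf (L2_cst 1).
by under eq_fun do rewrite mulr1.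
Qed.

Lemma L2Z (a : R) f : L2 f -> L2 (fun x => a * f x).
Proof.
move=> /L2P[mf fi]; apply/L2P; split; first exact: measurable_funM.
by under eq_fun do rewrite exprMn; exact: integrable_S1Z.
Qed.

Lemma L2D f g : L2 f -> L2 g -> L2 (fun x => f x + g x).
Proof.
move=> Lf Lg; apply/L2P; split.
  by apply: measurable_funD; exact: L2_measurable.
under eq_fun do rewrite sqrrD -mulr_natl.
apply: integrable_S1D; last exact: L2_sqr.
apply: integrable_S1D; first exact: L2_sqr.
exact/integrable_S1Z/L2_mul.
Qed.

Lemma L2B f g : L2 f -> L2 g -> L2 (fun x => f x - g x).
Proof.
move=> Lf Lg; under eq_fun do rewrite -mulN1r.
by apply: L2D => //; exact: L2Z.
Qed.

Lemma L2_le f g : meas_S1 f -> L2 g ->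
  (\forall x \ae leb, S1 x -> `|f x| <= g x) -> L2 f.
Proof.
move=> mf /L2P[mg gi] fg; apply/L2P; split => //; apply/integrableP; split; first exact/measurable_EFinP/measurable_funX.
have /integrableP[_] := gi; apply: le_lt_trans.
apply: ae_ge0_le_integral => //.
- exact/measurableT_comp/measurable_EFinP/measurable_funX.
- exact/measurableT_comp/measurable_EFinP/measurable_funX.
- apply: (ae_imp _ fg) => x /[apply] fgx /=.
  rewrite lee_fin !ger0_norm ?sqr_ge0// -[leLHS]real_normK ?num_real//.
  by rewrite lerXn2r// ?nnegrE ?(le_trans _ fgx).
Qed.

Lemma ae_eq_L2 f g : meas_S1 g -> ae_eq leb S1 f g -> L2 f -> L2 g.
Proof.
move=> mg fg Lf; have Ln : L2 (fun x => `|f x|).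
  have /L2P[mf fi] := Lf; apply/L2P; split; first exact: measurableT_comp.
  by under eq_fun do rewrite real_normK ?num_real//.
by apply: L2_le mg Ln _; apply: (ae_imp _ fg) => x /[apply] ->.
Qed.

Lemma ipC f g : ip f g = ip g f.
Proof. by apply: eq_intS1 => x _; rewrite mulrC. Qed.

Lemma ipDl f g h : L2 f -> L2 g -> L2 h ->
  ip (fun x => f x + g x) h = ip f h + ip g h.
Proof.
move=> Lf Lg Lh; rewrite -intS1D; [|exact: L2_mul..].
by apply: eq_intS1 => x _; rewrite mulrDl.
Qed.

Lemma ipBl f g h : L2 f -> L2 g -> L2 h ->
  ip (fun x => f x - g x) h = ip f h - ip g h.
Proof.
move=> Lf Lg Lh; rewrite -intS1B; [|exact: L2_mul..].
by apply: eq_intS1 => x _; rewrite mulrBl.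
Qed.

Lemma ipZl (a : R) f h : L2 f -> L2 h -> ip (fun x => a * f x) h = a * ip f h.
Proof.
move=> Lf Lh; rewrite -intS1Z; last exact: L2_mul.
by apply: eq_intS1 => x _; rewrite mulrA.
Qed.

Lemma ipDr f g h : L2 f -> L2 g -> L2 h ->
  ip h (fun x => f x + g x) = ip h f + ip h g.
Proof. by move=> *; rewrite ipC ipDl// ![ip h _]ipC. Qed.

Lemma ipBr f g h : L2 f -> L2 g -> L2 h ->
  ip h (fun x => f x - g x) = ip h f - ip h g.
Proof. by move=> *; rewrite ipC ipBl// ![ip h _]ipC. Qed.

Lemma ipZr (a : R) f h : L2 f -> L2 h -> ip h (fun x => a * f x) = a * ip h f.
Proof. by move=> *; rewrite ipC ipZl// ![ip h _]ipC. Qed.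

Lemma ip_ge0 f : 0 <= ip f f.
Proof. by apply: intS1_ge0 => x; rewrite -expr2 sqr_ge0. Qed.

Lemma ae_eq_ip f g f' g' : L2 f -> L2 g -> L2 f' -> L2 g' ->
  ae_eq leb S1 f f' -> ae_eq leb S1 g g' -> ip f g = ip f' g'.
Proof.
move=> Lf Lg Lf' Lg' ff gg; apply: ae_eq_intS1.
- by apply: measurable_funM; exact: L2_measurable.
- by apply: measurable_funM; exact: L2_measurable.
- by apply: (ae_imp2 _ ff gg) => x fx gx Sx; rewrite fx// gx.
Qed.

Definition nrm f : R := Num.sqrt (ip f f).

Lemma nrm_ge0 f : 0 <= nrm f. Proof. exact: sqrtr_ge0. Qed.

Lemma sqr_nrm f : nrm f ^+ 2 = ip f f.
Proof. by rewrite sqr_sqrtr// ip_ge0. Qed.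

Lemma normS1E w : L2 w -> normS1 2%:E w = (nrm w)%:E.
Proof.
move=> Lw; have : (normS1 2%:E w ^+ 2 = (nrm w)%:E ^+ 2)%E.
  by rewrite normS1_sqr EFin_intS1; [rewrite expe2 -EFinM -expr2 sqr_nrm|exact: L2_sqr].
have : (0 <= normS1 2%:E w)%E by exact: Lnorm_ge0.
case: Lw => _; case: (normS1 _ w) => // r _; rewrite lee_fin => r0.
rewrite !expe2 -!EFinM -!expr2 => -[] /eqP.
by rewrite eqrXn2 ?nrm_ge0// => /eqP ->.
Qed.

(** Cauchy-Schwarz, from the nonnegativity of the quadratic form
(a, b) |-> |a f + b g|^2. *)
Lemma ip_le f g : L2 f -> L2 g -> `|ip f g| <= nrm f * nrm g.
Proof.
move=> Lf Lg.
have key (a b : R) : 0 <= a ^+ 2 * ip f f + 2 * (a * b) * ip f g + b ^+ 2 * ip g g.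
  have := ip_ge0 (fun x => a * f x + b * g x).
  have La := L2Z a Lf; have Lb := L2Z b Lg.
  rewrite ipDl//; last exact: L2D.
  rewrite !ipDr// !ipZl// !ipZr// [ip g f]ipC.
  set p := ip f f; set q := ip f g; set r := ip g g; lra.
rewrite -ler_sqr ?nnegrE ?mulr_ge0 ?nrm_ge0// real_normK ?num_real//.
rewrite exprMn !sqr_nrm; have [f0|f0] := eqVneq (ip f f) 0.
  suff -> : ip f g = 0 by rewrite expr0n/= mulr_ge0// ip_ge0.
  apply/eqP/negPn/negP => fg0.
  (* With |f| = 0 the form is affine in a; this a makes it equal to - 1. *)
  have := key (- (ip g g + 1) / (2 * ip f g)) 1.
  rewrite f0 mulr0 add0r mulr1 expr1n mul1r.
  have -> : 2 * (- (ip g g + 1) / (2 * ip f g)) * ip f g = - (ip g g + 1) by field.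
  lra.
have fp : 0 < ip f f by rewrite lt_neqAle eq_sym f0 ip_ge0.
have := key (- ip f g) (ip f f).
rewrite -(pmulr_rge0 _ fp) => /=.
have -> : (- ip f g) ^+ 2 * ip f f + 2 * (- ip f g * ip f f) * ip f g +
   ip f f ^+ 2 * ip g g = ip f f * (ip f f * ip g g - ip f g ^+ 2) by ring.
by rewrite pmulr_rge0// pmulr_rge0// subr_ge0.
Qed.

Lemma nrmD f g : L2 f -> L2 g -> nrm (fun x => f x + g x) <= nrm f + nrm g.
Proof.
move=> Lf Lg; rewrite -ler_sqr ?nnegrE ?addr_ge0 ?nrm_ge0//.
rewrite sqrrD !sqr_nrm ipDl//; last exact: L2D.
rewrite !ipDr// [ip g f]ipC.
have := ip_le Lf Lg; have := ler_norm (ip f g).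
set a := nrm f * nrm g; set b := `|_|; rewrite -mulr_natl; lra.
Qed.

Lemma nrmZ (a : R) f : L2 f -> nrm (fun x => a * f x) = `|a| * nrm f.
Proof.
move=> Lf; rewrite /nrm ipZl ?ipZr//; last exact: L2Z.
by rewrite mulrA -expr2 sqrtrM ?sqr_ge0// sqrtr_sqr.
Qed.

Lemma ae_eq_nrm f g : L2 f -> L2 g -> ae_eq leb S1 f g -> nrm f = nrm g.
Proof. by move=> Lf Lg fg; rewrite /nrm (ae_eq_ip Lf Lf Lg Lg). Qed.

Lemma norm_intS1_le f : L2 f -> `|intS1 f| <= nrm f.
Proof.
move=> Lf; have := ip_le Lf (L2_cst 1).
have -> : ip f (fun=> 1) = intS1 f by apply: eq_intS1 => x _; rewrite mulr1.
have -> : nrm (fun=> 1) = 1.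
  rewrite /nrm (_ : ip _ _ = 1) ?sqrtr1//.
  by rewrite /ip; under [X in intS1 X]eq_fun do rewrite mulr1; rewrite intS1_cst.
by rewrite mulr1.
Qed.

Lemma L2_norm f : L2 f -> L2 (fun x => `|f x|).
Proof.
move=> /L2P[mf fi]; apply/L2P; split; first exact: measurableT_comp.
by under eq_fun do rewrite real_normK ?num_real//.
Qed.

Lemma intS1_norm_le f : L2 f -> intS1 (fun x => `|f x|) <= nrm f.
Proof.
move=> Lf; apply: le_trans (ler_norm _) _.
apply: le_trans (norm_intS1_le (L2_norm Lf)) _.
rewrite /nrm (_ : ip _ _ = ip f f)//; apply: eq_intS1 => x _.
by rewrite -!expr2 real_normK ?num_real.
Qed.

End S1_integral.
#[local] Hint Resolve measurable_S1 : core.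

(** * Primitives of integrable functions *)

Section primitive.
Context {R : realType}.
Implicit Types (a b f g h w : R -> R).
Local Notation leb := (@lebesgue_measure R).

Definition prim g (x : R) : R := (\int[leb]_(y in `[0%R, x]) g y)%R.

Lemma integrable_S1_sub (D : set (measurableTypeR R)) g : measurable D -> D `<=` S1 ->
  integrable_S1 g -> leb.-integrable D (EFin \o g).
Proof. by move=> mD DS; exact: integrableS. Qed.

Lemma integrable_patch (D : set (measurableTypeR R)) g : measurable D ->
  leb.-integrable D (EFin \o g) -> leb.-integrable setT (EFin \o (g \_ D)).
Proof. by move=> mD ig; rewrite -restrict_EFin; apply: (integrable_mkcond _ mD).1. Qed.

Lemma prim_set (x : R) : S1 x -> `[0%R, x] `<=` (S1 : set R).
Proof.
rewrite /S1/= in_itv/= => /andP[_ x1] y /=; rewrite !in_itv/= => /andP[-> yx].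
exact: le_trans x1.
Qed.

Lemma integrable_prim (x : R) g : S1 x -> integrable_S1 g ->
  leb.-integrable `[0%R, x] (EFin \o g).
Proof. by move=> Sx; apply: integrable_S1_sub => //; exact: prim_set. Qed.

(** The integrand a x * b y restricted to the triangle y <= x. *)
Let triangle (A B : R -> R) (z : measurableTypeR R * measurableTypeR R) : R :=
  if z.2 <= z.1 then A z.1 * B z.2 else 0.

Let triangle_measurable A B : measurable_fun [set: measurableTypeR R] A ->
  measurable_fun [set: measurableTypeR R] B -> measurable_fun setT (triangle A B).
Proof.
move=> mA mB; apply: measurable_fun_ifT => //.
- apply: measurable_fun_ler; [exact: measurable_snd|exact: measurable_fst].
- apply: measurable_funM.
  + exact: (measurableT_comp mA measurable_fst).
  + exact: (measurableT_comp mB measurable_snd).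
Qed.

Let triangle_integrable A B : leb.-integrable setT (EFin \o A) ->
  leb.-integrable setT (EFin \o B) ->
  (leb \x leb)%E.-integrable setT (EFin \o triangle A B).
Proof.
move=> iA iB; have mA := measurable_int _ iA; have mB := measurable_int _ iB.
move: (mA) (mB) => /measurable_EFinP mA' /measurable_EFinP mB'.
have mm := triangle_measurable mA' mB'.
apply/integrable12ltyP; first exact/measurable_EFinP.
have /integrableP[_ fA] := iA; have /integrableP[_ fB] := iB.
set C := (\int[leb]_x `|(EFin \o B) x|)%E in fB.
have C0 : (0 <= C)%E by apply: integral_ge0.
apply: (@le_lt_trans _ _ (\int[leb]_x (`|(EFin \o A) x| * C))%E).
  apply: ge0_le_integral => //.
  - by move=> x _; apply: integral_ge0.
  - apply: (measurable_fun_fubini_tonelli_F (m2 := leb) (fun z => `|(EFin \o triangle A B) z|)%E) => //.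
    exact/measurableT_comp/measurable_EFinP.
  - apply: emeasurable_funM => //; exact: measurableT_comp.
  - move=> x _; rewrite -ge0_integralZl//; last exact: measurableT_comp.
    apply: ge0_le_integral => //.
    + apply: measurableT_comp => //; apply/measurable_EFinP.
      exact: (measurableT_comp mm (measurable_pair1 x)).
    + by apply: emeasurable_funM => //; exact: measurableT_comp.
    + move=> y _ /=; rewrite /triangle/= lee_fin; case: ifP => _; first by rewrite normrM.
      by rewrite normr0 mulr_ge0.
rewrite ge0_integralZr//; last exact: measurableT_comp.
apply: lte_mul_pinfty => //; first by apply: integral_ge0.
by rewrite ge0_fin_numE//; apply: integral_ge0.
Qed.

(** Integration by parts for two merely integrable functions: both sides are
the integral of a x * b y over the triangle y <= x, in the two orders. *)
Lemma prim_by_parts a b : integrable_S1 a -> integrable_S1 b ->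
  intS1 (fun x => a x * prim b x) = intS1 (fun y => b y * (intS1 a - prim a y)).
Proof.
move=> ia ib; pose A := a \_ S1; pose B := b \_ S1.
have iA : leb.-integrable setT (EFin \o A).
  exact: integrable_patch.
have iB : leb.-integrable setT (EFin \o B).
  exact: integrable_patch.
have := Fubini (triangle_integrable iA iB).
have -> : (fun x => \int[leb]_y (EFin \o triangle A B) (x, y))%E =
   ((fun x => (a x * prim b x)%:E) \_ S1).
  apply/funext => x; rewrite patchE; case: ifPn => [/set_mem Sx|nSx].
    transitivity (\int[leb]_(y in `[0%R, x]) (a x * b y)%:E)%E.
      rewrite [RHS]integral_mkcond; apply: eq_integral => y _ /=.
      rewrite /triangle/= patchE /A /B !patchE (mem_set Sx).
      case: ifPn => yx.
        have [Sy|nSy] := boolP (y \in S1).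
          rewrite ifT//; apply/mem_set; move: Sy => /set_mem.
          by rewrite /S1/= !in_itv/= yx => /andP[->].
        rewrite mulr0 ifF//; apply/negbTE; apply: contra nSy => /set_mem h.
        exact/mem_set/(prim_set Sx).
      rewrite ifF//; apply/negbTE; apply: contra yx => /set_mem.
      by rewrite /= in_itv/= => /andP[].
    under eq_integral do rewrite EFinM.
    rewrite integralZl//; last exact: integrable_prim.
    rewrite EFinM /prim /Rintegral fineK//; apply: integrable_fin_num => //.
    exact: integrable_prim.
  rewrite integral0_eq// => y _ /=; rewrite /triangle /A /= patchE (negbTE nSx).
  by rewrite mul0r if_same.
have -> : (fun y => \int[leb]_x (EFin \o triangle A B) (x, y))%E =
   ((fun y => (b y * (intS1 a - prim a y))%:E) \_ S1).
  apply/funext => y; rewrite patchE; case: ifPn => [/set_mem Sy|nSy].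
    transitivity (\int[leb]_(x in `[y, 1%R]) (b y * a x)%:E)%E.
      rewrite [RHS]integral_mkcond; apply: eq_integral => x _ /=.
      rewrite /triangle/= patchE /A /B !patchE (mem_set Sy).
      case: ifPn => yx.
        have [Sx|nSx] := boolP (x \in S1).
          rewrite ifT ?[RHS]mulrC//; first by rewrite mulrC.
          apply/mem_set; move: Sx => /set_mem.
          by rewrite /S1/= !in_itv/= yx => /andP[].
        rewrite mul0r ifF//; apply/negbTE; apply: contra nSx => /set_mem h.
        apply/mem_set; move: h Sy; rewrite /S1/= !in_itv/= => /andP[h ->] /andP[h' _].
        by rewrite (le_trans h').
      rewrite ifF//; apply/negbTE; apply: contra yx => /set_mem.
      by rewrite /= in_itv/= => /andP[].
    have Sy1 : `[y, 1%R] `<=` (S1 : set R).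
      move=> z; move: Sy; rewrite /S1/= !in_itv/= => /andP[h _] /andP[h' ->].
      by rewrite (le_trans h).
    have iy1 : leb.-integrable `[y, 1%R] (EFin \o a) by exact: integrable_S1_sub.
    under eq_integral do rewrite EFinM.
    rewrite integralZl//.
    rewrite EFinM; congr (_ * _)%E.
    move: Sy; rewrite /S1/= in_itv/= => /andP[y0 y1].
    rewrite /intS1 /prim Rintegral_itvB ?bnd_simp// Rintegral_itv_obnd_cbnd//; last first.
      apply: integrable_S1_sub ia => //; apply: subset_trans Sy1.
      by apply: subset_itvr; rewrite bnd_simp.
    by rewrite /Rintegral fineK//; exact: integrable_fin_num.
  rewrite integral0_eq// => x _ /=; rewrite /triangle /B /= patchE (negbTE nSy).
  by rewrite mulr0 if_same.
by rewrite -!integral_mkcond /intS1 /Rintegral => ->.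
Qed.

Lemma norm_prim_le g (x : R) : integrable_S1 g -> S1 x ->
  `|prim g x| <= intS1 (fun x => `|g x|).
Proof.
move=> ig Sx; apply: le_trans (le_normr_Rintegral _ _) _ => //.
  by apply: integrable_prim.
rewrite /intS1 Rintegral_mkcond [leRHS]Rintegral_mkcond; apply: le_Rintegral => //.
- exact/integrable_patch/integrable_norm/integrable_prim.
- exact/integrable_patch/integrable_norm.
- move=> y _; rewrite !patchE; case: ifPn => [/set_mem h|_].
    by rewrite mem_set//; exact: prim_set h.
  by case: ifPn => _; [exact: normr_ge0|exact: lexx].
Qed.

Lemma prim_continuous g : integrable_S1 g -> {within S1, continuous (prim g)}.
Proof. by move=> ig; exact: parameterized_integral_continuous. Qed.

Lemma prim_measurable g : integrable_S1 g -> meas_S1 (prim g).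
Proof.
move=> ig; apply: subspace_continuous_measurable_fun.
  exact: measurable_S1.
exact: prim_continuous.
Qed.

Lemma prim_L2 g : integrable_S1 g -> L2 (prim g).
Proof.
move=> ig; apply: (L2_le (prim_measurable ig) (L2_cst (intS1 (fun x => `|g x|)))).
by apply: aeW => x; exact: norm_prim_le.
Qed.

Lemma prim1 g : prim g 1 = intS1 g.
Proof. by []. Qed.

Lemma prim0 g : prim g 0 = 0.
Proof. by rewrite /prim set_itv1 Rintegral_set1. Qed.

End primitive.

(** * Periodic smooth functions *)

Section test_functions.
Context {R : realType}.
Implicit Types (a b f g h w phi psi : R -> R).
Local Notation leb := (@lebesgue_measure R).

(** A class of 1-periodic functions closed under differentiation by
construction, hence consisting of test functions; the exponential is what makes
approximate step functions available in it. *)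
Inductive trig_expr : (R -> R) -> Prop :=
| Trig_cst c : trig_expr (fun=> c)
| Trig_cos c : trig_expr (fun x => cos (pi *+ 2 * x + c))
| Trig_add f g : trig_expr f -> trig_expr g -> trig_expr (fun x => f x + g x)
| Trig_mul f g : trig_expr f -> trig_expr g -> trig_expr (fun x => f x * g x)
| Trig_exp f : trig_expr f -> trig_expr (fun x => expR (f x)).

Lemma trig_expr_is_derive f : trig_expr f ->
  exists2 g, trig_expr g & forall x, is_derive x (1 : R) f (g x).
Proof.
elim=> {f} [c|c|f g _ [f' tf' df] _ [g' tg' dg]|f g tf [f' tf' df] tg [g' tg' dg]|f tf [f' tf' df]].
- by exists (fun=> 0); [exact: Trig_cst|move=> x; exact: is_derive_cst].
- exists (fun x => pi *+ 2 * cos (pi *+ 2 * x + (c + pi / 2))).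
    by apply: Trig_mul; [exact: Trig_cst|exact: Trig_cos].
  move=> x; have dl : is_derive x (1 : R) (fun x => pi *+ 2 * x + c) (pi *+ 2 : R).
    have dZ := @is_deriveZ _ _ _ id (pi *+ 2 : R) x 1 1 (is_derive_id _ _).
    have := @is_deriveD _ _ _ _ (cst c) x 1 _ 0 dZ (is_derive_cst _ _ _).
    by rewrite addr0 /GRing.scale/= mulr1.
  have := @is_derive1_comp _ (@cos R) (fun x => pi *+ 2 * x + c) x _ _ (is_derive_cos _) dl.
  by rewrite addrA cosDpihalf mulrC.
- exists (fun x => f' x + g' x); first exact: Trig_add.
  by move=> x; exact: is_deriveD.
- exists (fun x => f x * g' x + g x * f' x).
    by apply: Trig_add; exact: Trig_mul.
  by move=> x; exact: is_deriveM.
- exists (fun x => expR (f x) * f' x).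
    by apply: Trig_mul => //; exact: Trig_exp.
  by move=> x; exact: (is_derive1_comp (is_derive_expR _) (df x)).
Qed.

Lemma trig_expr_periodic f : trig_expr f -> forall x, f (x + 1) = f x.
Proof.
elim=> {f} // [c x|f g _ hf _ hg x|f g _ hf _ hg x|f _ hf x]; last 3 first.
- by rewrite hf hg.
- by rewrite hf hg.
- by rewrite hf.
by rewrite mulrDr mulr1 addrAC cosD2pi.
Qed.

Lemma trig_expr_derive1n f n : trig_expr f -> trig_expr (derive1n n f).
Proof.
move=> tf; elim: n => [//|n ih]; have [g tg dg] := trig_expr_is_derive ih.
suff -> : derive1n n.+1 f = g by [].
by apply/funext => x; rewrite derive1nS derive1E; have /@derive_val := dg x.
Qed.

Lemma trig_expr_test f : trig_expr f -> test_function f.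
Proof.
move=> tf; split; last exact: trig_expr_periodic.
move=> n x; have [g _ dg] := trig_expr_is_derive (trig_expr_derive1n n tf).
exact: ex_derive.
Qed.

Lemma test_continuous phi : test_function phi -> continuous phi.
Proof.
move=> [dphi _] x; apply: differentiable_continuous.
by apply/derivable1_diffP; exact: (dphi 0%N).
Qed.

Lemma test_derive1 phi : test_function phi -> test_function (derive1 phi).
Proof.
move=> [dphi per]; split.
  move=> n x; have -> : derive1n n (derive1 phi) = derive1n n.+1 phi.
    by rewrite /derive1n iterSr.
  exact: dphi.
have e : (fun x => phi (x + 1)) = phi by exact/funext.
move=> x; rewrite -[in RHS]e; have dp := dphi 0%N (x + 1).
have dl : is_derive x (1 : R) (fun x : R => x + 1) (1 : R).
  by apply: is_derive_eq; rewrite addr0.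
have := @is_derive1_comp _ phi (fun x => x + 1) x _ _ (DeriveDef dp erefl) dl.
by rewrite mulr1 => /@derive_val; rewrite !derive1E /comp => ->.
Qed.

Lemma test_cst (c : R) : test_function (fun=> c).
Proof. exact/trig_expr_test/Trig_cst. Qed.

Lemma testB phi psi : test_function phi -> test_function psi ->
  test_function (fun x => phi x - psi x).
Proof.
move=> [dphi pphi] [dpsi ppsi]; split; last by move=> x; rewrite pphi ppsi.
have e n : derive1n n (fun x => phi x - psi x) =
    (fun x => derive1n n phi x - derive1n n psi x).
  elim: n => // n ih; rewrite !derive1nS ih; apply/funext => x.
  rewrite derive1E (_ : (fun x => _) = derive1n n phi - derive1n n psi)//.
  by rewrite deriveB// !derive1E.
by move=> n x; rewrite e; apply: derivableB.
Qed.

Lemma continuous_S1_integrable f : {within S1, continuous f} -> integrable_S1 f.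
Proof.
move=> cf; apply: continuous_compact_integrable => //; exact: segment_compact.
Qed.

Lemma test_integrable phi : test_function phi -> integrable_S1 phi.
Proof.
move=> tphi; apply/continuous_S1_integrable/continuous_subspaceT.
exact: test_continuous.
Qed.

(** This is what makes the product with an integrable function integrable. *)
Lemma test_bounded phi : test_function phi ->
  exists2 M : R, 0 <= M & forall x, S1 x -> `|phi x| <= M.
Proof.
move=> /test_continuous cphi.
have cS : {within `[0, 1], continuous (fun x => `|phi x|)}.
  by apply: continuous_subspaceT => x; apply: cvg_norm; exact: cphi.
have [c _ hc] := EVT_max ler01 cS.
by exists `|phi c| => // x; exact: hc.
Qed.

Lemma test_measurable phi : test_function phi -> meas_S1 phi.
Proof. by move=> /test_integrable/integrable_S1_measurable. Qed.

Lemma integrable_mul_test g phi : integrable_S1 g -> test_function phi ->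
  integrable_S1 (fun x => g x * phi x).
Proof.
move=> ig tphi; have [M M0 hM] := test_bounded tphi.
apply: (@le_integrable_S1 _ _ (fun x => M * `|g x|)).
- apply: measurable_funM; first exact: integrable_S1_measurable.
  exact: test_measurable.
- by move=> x Sx; rewrite normrM mulrC ler_wpM2r// hM.
- exact/integrable_S1Z/integrable_norm.
Qed.

End test_functions.

(** * The fundamental lemma of the calculus of variations *)

Section fundamental_lemma.
Context {R : realType}.
Implicit Types (f g h w phi psi : R -> R).
Local Notation leb := (@lebesgue_measure R).

(** Equal to 2 sin (pi x) sin (pi (b - x)): a periodic function that is positive
on the arc from 0 to b and negative on the arc from b to 1. *)
Definition bump_exponent (b x : R) : R :=
  cos (pi *+ 2 * x + - (pi * b)) + - cos (pi * b).

(** With p = bump_exponent b this is 1 - exp (- exp (n p)), which tends to 1 where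
p > 0 and to 0 where p < 0.  It is spelled with sums and products only, to match
the constructors of trig_expr. *)
Definition smooth_step (b : R) (n : nat) (x : R) : R :=
  1 + (- 1) * expR ((- 1) * expR (n%:R * bump_exponent b x)).

Lemma smooth_step_test b n : test_function (smooth_step b n).
Proof.
apply: trig_expr_test; apply: Trig_add; first exact: Trig_cst.
apply: Trig_mul; first exact: Trig_cst.
apply: Trig_exp; apply: Trig_mul; first exact: Trig_cst.
apply: Trig_exp; apply: Trig_mul; first exact: Trig_cst.
by apply: Trig_add; [exact: Trig_cos|exact: Trig_cst].
Qed.

Lemma bump_exponentE (b x : R) :
  bump_exponent b x = 2 * (sin (pi * x) * sin (pi * (b - x))).
Proof.
rewrite /bump_exponent.
have -> : pi *+ 2 * x + - (pi * b) = pi * x - pi * (b - x) by rewrite mulr2n; ring.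
have -> : pi * b = pi * x + pi * (b - x) by ring.
by rewrite cosB [cos (_ + pi * (b - x))]cosD; ring.
Qed.

Lemma sin_pi_gt0 (x : R) : 0 < x < 1 -> 0 < sin (pi * x).
Proof.
move=> /andP[x0 x1]; apply: sin_gt0_pi.
by rewrite mulr_gt0 ?pi_gt0//= gtr_pMr ?pi_gt0.
Qed.

Lemma bump_exponent_gt0 (b x : R) : 0 < x -> x < b -> b < 1 -> 0 < bump_exponent b x.
Proof.
move=> x0 xb b1; rewrite bump_exponentE !mulr_gt0// sin_pi_gt0//; apply/andP; split; lra.
Qed.

Lemma bump_exponent_lt0 (b x : R) : 0 < b -> b < x -> x < 1 -> bump_exponent b x < 0.
Proof.
move=> x0 xb b1; rewrite bump_exponentE pmulr_rlt0// pmulr_rlt0.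
  rewrite -[b - x]opprB mulrN sinN oppr_lt0 sin_pi_gt0//; apply/andP; split; lra.
rewrite sin_pi_gt0//; apply/andP; split; lra.
Qed.

Lemma smooth_step_bounded (b x : R) n : `|smooth_step b n x| <= 1.
Proof.
rewrite /smooth_step !mulN1r ger0_norm; first by rewrite gerBl expR_ge0.
by rewrite subr_ge0 expR_le1 oppr_le0 expR_ge0.
Qed.

Lemma smooth_step_cvg1 (b x : R) : 0 < x -> x < b -> b < 1 ->
  smooth_step b ^~ x @ \oo --> (1 : R).
Proof.
move=> x0 xb b1; have p0 := bump_exponent_gt0 x0 xb b1.
pose q := expR (bump_exponent b x).
have q1 : 1 < q by rewrite expR_gt1.
suff h : (fun n => expR (- q ^+ n)) @ \oo --> (0 : R).
  rewrite (_ : smooth_step b ^~ x = (fun n => 1 - expR (- q ^+ n))); last first.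
    by apply/funext => n; rewrite /smooth_step !mulN1r expRM_natl.
  rewrite -[X in _ --> X](subr0 (1 : R)); apply: cvgB => //; exact: cvg_cst.
apply: (@squeeze_cvgr _ _ _ _ (fun=> 0 : R) (fun n => (q^-1) ^+ n)).
- apply: nearW => n; rewrite expR_ge0/= expRN exprVn lef_pV2.
  + by rewrite (le_trans _ (expR_ge1Dx (q ^+ n)))// lerDr.
  + by rewrite posrE expR_gt0.
  + by rewrite posrE exprn_gt0// (lt_trans ltr01).
- exact: cvg_cst.
- apply: cvg_expr; rewrite ger0_norm ?invr_ge0 ?(ltW (lt_trans ltr01 q1))//.
  by rewrite invf_lt1// (lt_trans ltr01).
Qed.

Lemma smooth_step_cvg0 (b x : R) : 0 < b -> b < x -> x < 1 ->
  smooth_step b ^~ x @ \oo --> (0 : R).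
Proof.
move=> x0 xb b1; have p0 := bump_exponent_lt0 x0 xb b1.
pose q := expR (bump_exponent b x).
have q1 : q < 1 by rewrite expR_lt1.
have h : (fun n => q ^+ n) @ \oo --> (0 : R).
  by apply: cvg_expr; rewrite ger0_norm ?expR_ge0.
have h2 : (fun n => expR (- q ^+ n)) @ \oo --> (1 : R).
  rewrite -[X in _ --> X]expR0 -[X in expR X]oppr0.
  by apply: continuous_cvg; [exact: continuous_expR|exact: cvgN].
rewrite (_ : smooth_step b ^~ x = (fun n => 1 - expR (- q ^+ n))); last first.
    by apply/funext => n; rewrite /smooth_step !mulN1r expRM_natl.
  rewrite -[X in _ --> X](subrr (1 : R)); apply: cvgB => //; exact: cvg_cst.
Qed.

Lemma ae_neq (c : R) : \forall x \ae leb, x != c.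
Proof.
exists [set c]; split => //; first by rewrite lebesgue_measure_set1.
by move=> x /= /negP; rewrite negbK => /eqP.
Qed.

(** The step functions are bounded by 1 and tend a.e. to the indicator of the
interval from 0 to b, so dominated convergence applies. *)
Lemma prim_eq0 h (b : R) : integrable_S1 h ->
  (forall phi, test_function phi -> intS1 (fun x => h x * phi x) = 0) ->
  0 < b -> b < 1 -> prim h b = 0.
Proof.
move=> ih h0 b0 b1; have mh := integrable_S1_measurable ih.
have Sb : S1 b by rewrite /S1/= in_itv/= !ltW.
pose f_ n x := (h x * smooth_step b n x)%:E.
pose f x := (EFin \o (h \_ `[0, b])) x.
have mf_ n : measurable_fun (S1 : set (measurableTypeR R)) (f_ n).
  apply/measurable_EFinP; apply: measurable_funM => //.
  by apply: test_measurable; exact: smooth_step_test.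
have mf : measurable_fun (S1 : set (measurableTypeR R)) f.
  apply: measurable_funTS; apply: measurable_int.
  exact/integrable_patch/integrable_prim.
have cf : {ae leb, forall x, S1 x -> f_ ^~ x @ \oo --> f x}.
  apply: (ae_imp2 _ (ae_neq b) (ae_imp2 _ (ae_neq 0) (ae_neq 1))); last first.
    move=> x; exact: pair.
  move=> x xb [x0 x1]; rewrite /S1/= in_itv/= => /andP[x0' x1'].
  have {}x0 : 0 < x by rewrite lt_neqAle eq_sym x0.
  have {}x1 : x < 1 by rewrite lt_neqAle x1.
  apply: cvg_EFin; first by apply: nearW.
  rewrite /f/= patchE; case: ifPn => [/set_mem|/negP nx].
    rewrite /= in_itv/= => /andP[_ xb'].
    have {}xb : x < b by rewrite lt_neqAle xb.
    rewrite -[X in _ --> X]mulr1; apply: cvgM; first exact: cvg_cst.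
    exact: smooth_step_cvg1.
  have {}xb : b < x.
    rewrite ltNge; apply/negP => xb'; apply: nx; apply/mem_set.
    by rewrite /= in_itv/= x0'.
  rewrite -[X in _ --> X](mulr0 (h x)); apply: cvgM; first exact: cvg_cst.
  exact: smooth_step_cvg0.
have bf : {ae leb, forall x n, S1 x -> (`|f_ n x| <= `|(h x)%:E|)%E}.
  apply: aeW => x n _ /=; rewrite lee_fin normrM ler_piMr//.
  exact: smooth_step_bounded.
have [_ _ ] := dominated_convergence measurable_S1 mf_ mf cf (integrable_abse ih) bf.
have -> : [sequence (\int[leb]_(x in S1) f_ n x)%E]_n = (fun=> 0%E).
  apply/funext => n; have tn := smooth_step_test b n.
  by have := EFin_intS1 (integrable_mul_test ih tn); rewrite h0.
move=> /(cvg_lim (@ereal_hausdorff R)); rewrite lim_cst//.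
move=> e; rewrite /prim /Rintegral.
rewrite (_ : (\int[_]_(x in _) _)%E = (\int[leb]_(x in S1) f x)%E); first by rewrite -e.
rewrite integral_mkcond [RHS]integral_mkcond; apply: eq_integral => x _.
rewrite /f !patchE/= patchE; case: ifPn => [/set_mem xb|_].
  by rewrite mem_set//; exact: prim_set xb.
by case: ifPn => _; rewrite /= ?patchE.
Qed.

(** All primitives of h vanish, and h is a.e. the derivative of its primitive by
Lebesgue's differentiation theorem. *)
Lemma fundamental_lemma h : integrable_S1 h ->
  (forall phi, test_function phi -> intS1 (fun x => h x * phi x) = 0) ->
  ae_eq leb S1 h (fun=> 0).
Proof.
move=> ih h0; pose H := h \_ S1.
have iH : leb.-integrable setT (EFin \o H) by exact: integrable_patch.
have lH : locally_integrable [set: R] H.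
  by have := integrable_locally measurable_S1 ih.
have iy (y : R) : leb.-integrable `]-oo, y] (EFin \o H) by exact: integrableS iH.
apply: (ae_imp2 _ (FTC1Ny iy lH) (ae_imp2 _ (ae_neq 0) (ae_neq 1))); last first.
  move=> x; exact: pair.
move=> x /= [_ dF] [x0 x1]; rewrite /S1/= in_itv/= => /andP[x0' x1'].
have {}x0 : 0 < x by rewrite lt_neqAle eq_sym x0.
have {}x1 : x < 1 by rewrite lt_neqAle x1.
have -> : h x = H x by rewrite /H patchE mem_set// /S1/= in_itv/= x0'.
rewrite -dF derive1E; transitivity ('D_1 (cst (0 : R)) x); last by rewrite derive_cst.
apply: near_eq_derive; near=> y.
have y0 : 0 < y by near: y; exact: lt_nbhsr.
have y1 : y < 1 by near: y; exact: lt_nbhsl.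
rewrite /= -[RHS](prim_eq0 ih h0 y0 y1) /prim [LHS]Rintegral_mkcond [RHS]Rintegral_mkcond.
apply: eq_Rintegral => z _; rewrite !patchE /H patchE.
case: ifPn => [/set_mem|nz]; case: ifPn => //; first by move=> /set_mem; rewrite /S1/= !in_itv/= => /andP[z0 _] zy; rewrite mem_set//= in_itv/= z0.
- move=> nS; rewrite /= in_itv/= => zy; rewrite ifF//; apply/negbTE; apply: contra nS => /set_mem zz.
  apply/mem_set; move: zz; rewrite /S1/= !in_itv/= => /andP[-> _].
  by rewrite (le_trans zy)// ltW.
- move=> /set_mem; rewrite /= in_itv/= => /andP[_ zy]; exfalso; move/negP: nz; apply.
  by apply/mem_set; rewrite /= in_itv.
Unshelve. all: by end_near. Qed.

(** The mean of psi is the increment of its antiderivative over one period, so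
mean zero is what makes the antiderivative periodic. *)
Lemma test_antiderivative psi : test_function psi -> intS1 psi = 0 ->
  exists2 phi, test_function phi & derive1 phi = psi.
Proof.
move=> tpsi psi0; have cpsi := test_continuous tpsi.
pose itg (x y : R) : R := (\int[leb]_(t in `[x, y]) psi t)%R.
have ipsi (x y : R) : leb.-integrable `[x, y] (EFin \o psi).
  apply: continuous_compact_integrable => //; first exact: segment_compact.
  exact: continuous_subspaceT.
have itgD (x y z : R) : x <= y -> y <= z -> itg x z = itg x y + itg y z.
  move=> xy yz; rewrite addrC /itg; apply/eqP; rewrite -subr_eq; apply/eqP.
  rewrite Rintegral_itvB ?bnd_simp// Rintegral_itv_obnd_cbnd//.
  apply: integrableS (ipsi y z) => //; apply: subset_itvr; by rewrite bnd_simp.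
(* The primitive vanishing at 0, for both signs of x: one term is always zero. *)
pose phi x := itg 0 x - itg x 0.
have itg_gt (x y : R) : y < x -> itg x y = 0.
  by move=> yx; rewrite /itg set_itv_ge ?Rintegral_set0// -leNgt bnd_simp.
have itgx (x : R) : itg x x = 0 by rewrite /itg set_itv1 Rintegral_set1.
have phiE (a x : R) : a <= 0 -> a <= x -> phi x = itg a x - itg a 0.
  move=> a0 ax; rewrite /phi; have [x0|x0] := leP 0 x.
    rewrite (itgD a 0 x)//; move: x0; rewrite le_eqVlt => /predU1P[<-|x0].
      by rewrite itgx; ring.
    by rewrite (itg_gt x 0)//; ring.
  by rewrite (itg_gt 0 x)// (itgD a x 0 ax (ltW x0)); ring.
have dphi (x : R) : is_derive x (1 : R) phi (psi x).
  (* A base point to the left of 0 and of a neighbourhood of x. *)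
  pose a : R := - (`|x| + 1).
  have ax : a < x by rewrite /a ltrNl; apply: le_lt_trans (ler_norm _) _; rewrite normrN ltrDl.
  have a0 : a < 0 by rewrite oppr_lt0 ltr_wpDl.
  have x1 : x < x + 1 by rewrite ltrDl.
  have [d1 d2] := @continuous_FTC1_closed R psi a x (x + 1) x1 (ipsi _ _) ax (cpsi x).
  apply: (@near_eq_is_derive _ _ _ (fun y => itg a y - itg a 0)).
    near=> y; rewrite (phiE a) ?ltW//.
    by near: y; exact: lt_nbhsr.
  have d3 : is_derive x 1 (itg a) (psi x) by rewrite -d2 derive1E; exact: DeriveDef.
  have := @is_deriveB _ _ _ _ (cst (itg a 0)) x 1 _ 0 d3 (is_derive_cst _ _ _).
  by rewrite subr0.
have e : derive1 phi = psi.
  by apply/funext => x; rewrite derive1E; have /@derive_val := dphi x.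
exists phi => //; split.
  move=> [|n] x; first exact: ex_derive.
  have -> : derive1n n.+1 phi = derive1n n psi by rewrite /derive1n iterSr e.
  by case: tpsi.
move=> x.
have d0 (y : R) : is_derive y 1 (fun x => phi (x + 1) - phi x) 0.
  have dl : is_derive y (1 : R) (fun x : R => x + 1) (1 : R).
    have := @is_deriveD _ _ _ _ (cst (1 : R)) y 1 _ 0 (is_derive_id _ _) (is_derive_cst _ _ _).
    by rewrite addr0.
  have d1 := @is_derive1_comp _ phi (fun x => x + 1) y _ _ (dphi _) dl.
  have := is_deriveB d1 (dphi y); rewrite mulr1; case: tpsi => _ ->.
  by rewrite subrr.
have := is_derive_0_is_cst x 0 d0; rewrite /= add0r => h.
apply/eqP; rewrite -subr_eq0 h /phi.
rewrite (itg_gt 1 0)// itgx !subr0; apply/eqP.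
by rewrite -[RHS]psi0.
Unshelve. all: by end_near. Qed.

End fundamental_lemma.

(** * Weak derivatives on the circle *)

Section weak_derivative.
Context {R : realType}.
Implicit Types (f g h w z phi psi : R -> R) (k j : nat).
Local Notation leb := (@lebesgue_measure R).

Lemma primitive_derivative (F f : R -> R) (x : R) : S1 x ->
  {within S1, continuous f} -> {within S1, continuous F} ->
  (forall y : R, 0 < y < 1 -> is_derive y 1 F (f y)) ->
  prim f x = F x - F 0.
Proof.
rewrite /S1/= in_itv/= => /andP[+ x1] cf cF dF.
rewrite le_eqVlt => /predU1P[<-|x0]; first by rewrite prim0 subrr.
have sub : `[0, x] `<=` (S1 : set R) by apply: subset_itvl; rewrite bnd_simp.
have cfx : {within `[0, x], continuous f} by exact: continuous_subspaceW cf.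
have cFx : {within `[0, x], continuous F} by exact: continuous_subspaceW cF.
have [_ Fr Fl] := (continuous_within_itvP _ x0).1 cFx.
rewrite /prim /Rintegral (@continuous_FTC2 _ f F)//.
- split => // y; rewrite in_itv/= => /andP[y0 yx].
  apply: ex_derive; apply: dF; by rewrite y0 (lt_le_trans yx).
- move=> y; rewrite in_itv/= => /andP[y0 yx]; rewrite derive1E.
  have yi : 0 < y < 1 by rewrite y0 (lt_le_trans yx).
  by have /@derive_val := dF y yi.
Qed.

Lemma test_is_derive phi : test_function phi ->
  forall x, is_derive x (1 : R) phi (derive1 phi x).
Proof.
by move=> [dphi _] x; rewrite derive1E; apply: DeriveDef => //; exact: (dphi 0%N).
Qed.

Lemma prim_derive1 phi (x : R) : test_function phi -> S1 x ->
  prim (derive1 phi) x = phi x - phi 0.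
Proof.
move=> tphi Sx; apply: primitive_derivative => //.
- by apply/continuous_subspaceT/test_continuous/test_derive1.
- by apply/continuous_subspaceT/test_continuous.
- by move=> y _; exact: test_is_derive.
Qed.

Lemma S1_1 : S1 (1 : R). Proof. by rewrite /S1/= in_itv/= lexx ler01. Qed.

Lemma intS1_derive1 phi : test_function phi -> intS1 (derive1 phi) = 0.
Proof.
move=> tphi; rewrite -prim1 (prim_derive1 tphi S1_1).
by case: tphi => _ per; rewrite -[1]add0r per subrr.
Qed.

(** Integration by parts against a test function; the boundary terms disappear
because both the test function and the primitive are periodic, the latter by
the vanishing mean of g. *)
Lemma wderiv1_prim (c : R) g : integrable_S1 g -> intS1 g = 0 ->
  is_wderiv 1 (fun x => c + prim g x) g.
Proof.
move=> ig g0; have ipg := L2_integrable (prim_L2 ig).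
split => //; first by apply: integrable_S1D => //; exact: integrable_S1_cst.
move=> phi tphi; have td := test_derive1 tphi.
have id := test_integrable td.
rewrite expr1 mulN1r -!/(intS1 _) /derive1n/=.
have -> : intS1 (fun x => (c + prim g x) * derive1 phi x) =
    c * intS1 (derive1 phi) + intS1 (fun x => derive1 phi x * prim g x).
  rewrite -intS1Z// -intS1D.
  - by apply: eq_intS1 => x _; ring.
  - exact: integrable_S1Z.
  - by under eq_fun do rewrite mulrC; exact: integrable_mul_test.
rewrite (prim_by_parts id ig) !intS1_derive1// mulr0 add0r.
rewrite (@eq_intS1 _ _ (fun y => (- 1) * (g y * phi y) + phi 0 * g y)).
  rewrite intS1D; [|exact/integrable_S1Z/integrable_mul_test|exact: integrable_S1Z].
  by rewrite !intS1Z//; [rewrite g0; ring|exact: integrable_mul_test].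
by move=> y Sy; rewrite prim_derive1//; ring.
Qed.

(** The constant 1 is a test function. *)
Lemma wderiv1_int0 w g : is_wderiv 1 w g -> intS1 g = 0.
Proof.
move=> [iw ig] /(_ _ (test_cst 1)); rewrite -!/(intS1 _) expr1 mulN1r.
rewrite (@eq_intS1 _ _ (fun=> 0)); last first.
  by move=> x _; rewrite /derive1n/= derive1_cst mulr0.
rewrite intS1_cst => /esym/eqP; rewrite oppr_eq0 => /eqP <-.
by apply: eq_intS1 => x _; rewrite mulr1.
Qed.

(** The difference of w and the primitive of g has weak derivative zero, so it is
orthogonal to all derivatives of test functions, that is to all test functions
of mean zero; the fundamental lemma makes it constant. *)
Lemma wderiv1_repr w g : is_wderiv 1 w g ->
  exists c : R, ae_eq leb S1 w (fun x => c + prim g x).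
Proof.
move=> wg; have g0 := wderiv1_int0 wg; case: (wg) => iw ig wgP.
have ipg := L2_integrable (prim_L2 ig).
pose h x := w x - prim g x; have ih : integrable_S1 h by exact: integrable_S1B.
exists (intS1 h).
have ihc : integrable_S1 (fun x => h x - intS1 h).
  by apply: integrable_S1B => //; exact: integrable_S1_cst.
suff H : ae_eq leb S1 (fun x => h x - intS1 h) (fun=> 0).
  apply: (ae_imp _ H) => x hx Sx; have := hx Sx; rewrite /h; lra.
apply: fundamental_lemma => // psi tpsi.
have tc := test_cst (intS1 psi); have tm := testB tpsi tc.
have ipsi := test_integrable tpsi.
have m0 : intS1 (fun x => psi x - intS1 psi) = 0.
  by rewrite intS1B ?intS1_cst ?subrr//; exact: integrable_S1_cst.
have [phi tphi dphi] := test_antiderivative tm m0.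
have [_ _ pP] := wderiv1_prim 0 ig g0.
have e : intS1 (fun x => w x * (psi x - intS1 psi)) =
         intS1 (fun x => (0 + prim g x) * (psi x - intS1 psi)).
  have := wgP phi tphi; rewrite -pP// -!/(intS1 _).
  by rewrite /derive1n/= dphi.
have i1 : integrable_S1 (fun x => w x * (psi x - intS1 psi)) by exact: integrable_mul_test.
have i2 : integrable_S1 (fun x => (0 + prim g x) * (psi x - intS1 psi)).
  by apply: integrable_mul_test => //; under eq_fun do rewrite add0r.
rewrite (@eq_intS1 _ _ (fun x => (w x * (psi x - intS1 psi) -
    (0 + prim g x) * (psi x - intS1 psi)) + (intS1 psi * h x - intS1 h * psi x))); last first.
  by move=> x _; rewrite /h; ring.
have i3 := integrable_S1Z (intS1 psi) ih.
have i4 := integrable_S1Z (intS1 h) ipsi.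
rewrite intS1D; [|exact: integrable_S1B..].
rewrite [X in X + _](intS1B i1 i2) e [X in _ + X](intS1B i3 i4).
by rewrite !intS1Z//; ring.
Qed.

Lemma wderiv_unique k w g g' : is_wderiv k w g -> is_wderiv k w g' ->
  ae_eq leb S1 g g'.
Proof.
move=> [_ ig gP] [_ ig' gP'].
suff H : ae_eq leb S1 (fun x => g x - g' x) (fun=> 0).
  by apply: (ae_imp _ H) => x hx Sx; apply/eqP; rewrite -subr_eq0 hx.
apply: fundamental_lemma; first exact: integrable_S1B.
move=> phi tphi; have := gP _ tphi; rewrite gP'// -!/(intS1 _) => /eqP.
rewrite -subr_eq0 -mulrBr mulf_eq0 signr_eq0/= => /eqP e.
rewrite -oppr0 -e opprB -intS1B; [|exact: integrable_mul_test..].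
by apply: eq_intS1 => x _; ring.
Qed.

Lemma wderiv_eq k w g w' g' : is_wderiv k w g -> integrable_S1 w' -> integrable_S1 g' ->
  ae_eq leb S1 w w' -> ae_eq leb S1 g g' -> is_wderiv k w' g'.
Proof.
move=> [iw ig wg] iw' ig' ww gg; split => // phi tphi; have := wg _ tphi.
have tk : test_function (derive1n k phi).
  by elim: (k) => // n; exact: test_derive1.
rewrite -!/(intS1 _).
rewrite (@ae_eq_intS1 _ (fun x => w' x * derive1n k phi x) (fun x => w x * derive1n k phi x)); last 3 first.
- by apply: integrable_S1_measurable; exact: integrable_mul_test.
- by apply: integrable_S1_measurable; exact: integrable_mul_test.
- by apply: (ae_imp _ ww) => x /[apply] ->.
move=> ->; congr (_ * _); apply: ae_eq_intS1.
- by apply: integrable_S1_measurable; exact: integrable_mul_test.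
- by apply: integrable_S1_measurable; exact: integrable_mul_test.
- by apply: (ae_imp _ gg) => x /[apply] ->.
Qed.

Lemma test_derive1n k phi : test_function phi -> test_function (derive1n k phi).
Proof. by move=> t; elim: k => // n; exact: test_derive1. Qed.

Lemma wderiv0 w : integrable_S1 w -> is_wderiv 0 w w.
Proof. by move=> iw; split => // phi _; rewrite expr0 mul1r. Qed.

(** Derivatives of test functions are test functions. *)
Lemma wderiv_next k w g h : is_wderiv k w g -> is_wderiv k.+1 w h -> is_wderiv 1 g h.
Proof.
move=> [iw ig wg] [_ ih wh]; split => // phi tphi.
have := wg _ (test_derive1 tphi); rewrite /derive1n -iterSr => e.
have := wh _ tphi; rewrite /derive1n e exprSr -mulrA.
by move=> /(mulfI (negbT (signr_eq0 _ _))); rewrite expr1.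
Qed.

Lemma wderivD k w g w' g' : is_wderiv k w g -> is_wderiv k w' g' ->
  is_wderiv k (fun x => w x + w' x) (fun x => g x + g' x).
Proof.
move=> [iw ig wg] [iw' ig' wg']; split; [exact: integrable_S1D..|].
move=> phi tphi; have tk := test_derive1n k tphi.
have := wg _ tphi; have := wg' _ tphi; rewrite -!/(intS1 _) => e' e.
rewrite (@eq_intS1 _ _ (fun x => w x * derive1n k phi x + w' x * derive1n k phi x));
  last by move=> x _; rewrite mulrDl.
rewrite intS1D ?e ?e'; [|exact: integrable_mul_test..].
rewrite -mulrDr -intS1D; [|exact: integrable_mul_test..].
by congr (_ * _); apply: eq_intS1 => x _; rewrite mulrDl.
Qed.

Lemma wderivZ k (a : R) w g : is_wderiv k w g ->
  is_wderiv k (fun x => a * w x) (fun x => a * g x).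
Proof.
move=> [iw ig wg]; split; [exact: integrable_S1Z..|].
move=> phi tphi; have tk := test_derive1n k tphi.
have := wg _ tphi; rewrite -!/(intS1 _) => e.
rewrite (@eq_intS1 _ _ (fun x => a * (w x * derive1n k phi x)));
  last by move=> x _; rewrite mulrA.
rewrite intS1Z ?e; last exact: integrable_mul_test.
rewrite mulrCA -intS1Z; last exact: integrable_mul_test.
by congr (_ * _); apply: eq_intS1 => x _; rewrite mulrA.
Qed.

Lemma wderivB k w g w' g' : is_wderiv k w g -> is_wderiv k w' g' ->
  is_wderiv k (fun x => w x - w' x) (fun x => g x - g' x).
Proof.
move=> wg wg'; have := wderivD wg (wderivZ (-1) wg').
by under eq_fun do rewrite mulN1r; under [X in is_wderiv _ _ X]eq_fun do rewrite mulN1r.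
Qed.

(** With w and z replaced by their primitives this is prim_by_parts; the additive
constants do not contribute since the derivatives have mean zero. *)
Lemma ip_by_parts w w' z z' : is_wderiv 1 w w' -> is_wderiv 1 z z' ->
  L2 w -> L2 w' -> L2 z -> L2 z' -> ip w z' = - ip w' z.
Proof.
move=> ww zz Lw Lw' Lz Lz'.
have w0 := wderiv1_int0 ww; have z0 := wderiv1_int0 zz.
have [c we] := wderiv1_repr ww; have [d ze] := wderiv1_repr zz.
have iw' := L2_integrable Lw'; have iz' := L2_integrable Lz'.
have Lpw := prim_L2 iw'; have Lpz := prim_L2 iz'.
rewrite (ae_eq_ip Lw Lz' (L2D (L2_cst c) Lpw) Lz' we (ae_eq_refl _ _ _)).
rewrite (ae_eq_ip Lw' Lz Lw' (L2D (L2_cst d) Lpz) (ae_eq_refl _ _ _) ze).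
rewrite ipDl//; last exact: L2_cst.
rewrite ipDr//; last exact: L2_cst.
have -> : ip (fun=> c) z' = 0 by rewrite /ip intS1Z// z0 mulr0.
have -> : ip w' (fun=> d) = 0 by rewrite ipC /ip intS1Z// w0 mulr0.
rewrite !add0r ipC /ip (prim_by_parts iz' iw') z0 -mulN1r -intS1Z; last exact: L2_mul.
by apply: eq_intS1 => x _; ring.
Qed.

Lemma wderivP k w : (exists g, is_wderiv k w g) -> is_wderiv k w (wderiv k w).
Proof. by move=> [g wg]; rewrite /wderiv; case: xgetP => [h _|/(_ g)]. Qed.

Lemma Hk_wderiv k j w : Hk k w -> (j <= k)%N -> is_wderiv j w (wderiv j w).
Proof. by move=> [_ /[apply]] [g wg _]; apply: wderivP; exists g. Qed.

Lemma L2_wderiv j w g : is_wderiv j w g -> L2 g -> L2 (wderiv j w).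
Proof.
move=> wg Lg; have wd : is_wderiv j w (wderiv j w) by apply: wderivP; exists g.
apply: ae_eq_L2 (wderiv_unique wg wd) Lg.
by case: wd => _ /integrable_S1_measurable.
Qed.

Lemma Hk_L2_wderiv k j w : Hk k w -> (j <= k)%N -> L2 (wderiv j w).
Proof. by move=> [_ /[apply]] [g]; exact: L2_wderiv. Qed.

Lemma HkB k w z : Hk k w -> Hk k z -> Hk k (fun x => w x - z x).
Proof.
move=> [Lw Hw] [Lz Hz]; split; first exact: L2B.
move=> j jk; have [g wg Lg] := Hw _ jk; have [h zh Lh] := Hz _ jk.
by exists (fun x => g x - h x); [exact: wderivB|exact: L2B].
Qed.

Lemma HkZ k (a : R) w : Hk k w -> Hk k (fun x => a * w x).
Proof.
move=> [Lw Hw]; split; first exact: L2Z.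
move=> j jk; have [g wg Lg] := Hw _ jk.
by exists (fun x => a * g x); [exact: wderivZ|exact: L2Z].
Qed.

(** The embedding of H^1 into L^oo: w is a constant plus the primitive of w', the
primitive is bounded by the L^1 norm of w', and the constant is the mean of w
minus the mean of the primitive. *)
Lemma sobolev_sup w w' : is_wderiv 1 w w' -> L2 w -> L2 w' ->
  \forall x \ae leb, S1 x -> `|w x| <= nrm w + 2 * nrm w'.
Proof.
move=> ww Lw Lw'; have [c we] := wderiv1_repr ww.
have iw' := L2_integrable Lw'; have Lp := prim_L2 iw'.
have hp x : S1 x -> `|prim w' x| <= nrm w'.
  by move=> Sx; rewrite (le_trans (norm_prim_le iw' Sx))// intS1_norm_le.
have hc : `|c| <= nrm w + nrm w'.
  have -> : c = intS1 w - intS1 (prim w').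
    rewrite (ae_eq_intS1 _ _ we).
    - by rewrite intS1D ?intS1_cst ?addrK//; [exact: integrable_S1_cst|exact: L2_integrable].
    - exact: L2_measurable.
    - by apply: L2_measurable; apply: L2D => //; exact: L2_cst.
  rewrite (le_trans (ler_normB _ _))// lerD ?norm_intS1_le//.
  have := L2_norm Lp => Lnp; rewrite /intS1.
  apply: le_trans (le_normr_Rintegral _ _) _ => //; first exact: L2_integrable.
  rewrite -[leRHS]intS1_cst; apply: le_Rintegral => //.
  - exact: L2_integrable.
  - exact: integrable_S1_cst.
apply: (ae_imp _ we) => x wx Sx; rewrite wx//.
by rewrite (le_trans (ler_normD _ _))// mulr2n mulrDl !mul1r addrA lerD// hp.
Qed.

End weak_derivative.

(** * The chain rule *)

Section chain_rule.
Context {R : realType}.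
Local Notation leb := (@lebesgue_measure R).

Lemma ae_eq_prim (f g : R -> R) (x : R) : S1 x -> integrable_S1 f -> integrable_S1 g ->
  ae_eq leb S1 f g -> prim f x = prim g x.
Proof.
move=> Sx ia ib fg; congr fine; apply: ae_eq_integral => //.
- exact: (measurable_int _ (integrable_prim Sx ia)).
- exact: (measurable_int _ (integrable_prim Sx ib)).
- by apply: (ae_imp _ fg) => y fgy /(prim_set Sx)/fgy /= ->.
Qed.

Lemma is_derive_prim (f : R -> R) (T x : R) : {within `[0, T], continuous f} ->
  0 < x < T -> is_derive x (1 : R) (prim f) (f x).
Proof.
move=> cf /andP[x0 xT]; have T0 := lt_trans x0 xT.
have cfx : {for x, continuous f}.
  have [h _ _] := (continuous_within_itvP f T0).1 cf.
  by apply: h; rewrite in_itv/= x0.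
have iT : leb.-integrable `[0, T] (EFin \o f).
  by apply: continuous_compact_integrable => //; exact: segment_compact.
have [d1 d2] := @continuous_FTC1_closed R f 0 x T xT iT x0 cfx.
by rewrite -d2 derive1E; exact: DeriveDef.
Qed.

(** Two weak derivatives make u a.e. equal to a C^1 function U, so the classical
chain rule applies to G o U, and the result is transported back to u through
the representation of weak derivatives by primitives. *)
Lemma wderiv1_comp (G g u u' u'' : R -> R) :
  (forall x, is_derive x (1 : R) G (g x)) -> continuous g ->
  is_wderiv 1 u u' -> is_wderiv 1 u' u'' ->
  is_wderiv 1 (fun x => G (u x)) (fun x => g (u x) * u' x).
Proof.
move=> dG cg uu' uu''.
have cG : continuous G.
  by move=> x; apply: differentiable_continuous; apply/derivable1_diffP; exact: ex_derive.
have [iu iu' _] := uu'; have [_ iu'' _] := uu''.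
have [c uE] := wderiv1_repr uu'; have [d u'E] := wderiv1_repr uu''.
pose V x := d + prim u'' x; pose U x := c + prim V x.
have cV : {within S1, continuous V}.
  by move=> x; apply: cvgD; [exact: cvg_cst|exact: prim_continuous].
have iV := continuous_S1_integrable cV.
have cU : {within S1, continuous U}.
  by move=> x; apply: cvgD; [exact: cvg_cst|exact: prim_continuous].
have uU : ae_eq leb S1 u U.
  by apply: (ae_imp _ uE) => x ux Sx; rewrite ux// /U (ae_eq_prim Sx iu' iV u'E).
pose h x := g (U x) * V x.
have cgU : {within S1, continuous (fun x => g (U x))}.
  by move=> x; apply: continuous_comp; [exact: cU|exact: cg].
have cGU : {within S1, continuous (fun x => G (U x))}.
  by move=> x; apply: continuous_comp; [exact: cU|exact: cG].
have ch : {within S1, continuous h} by move=> x; apply: cvgM; [exact: cgU|exact: cV].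
have dGU (y : R) : 0 < y < 1 -> is_derive y (1 : R) (fun x => G (U x)) (h y).
  move=> y01; have dU : is_derive y (1 : R) U (V y).
    have := @is_deriveD _ _ _ (cst c) _ y 1 0 _ (is_derive_cst _ _ _) (is_derive_prim cV y01).
    by rewrite add0r.
  exact: (@is_derive1_comp _ G U y _ _ (dG _) dU).
have hE (x : R) : S1 x -> G (U x) = G (U 0) + prim h x.
  by move=> Sx; rewrite (primitive_derivative Sx ch cGU dGU); ring.
have ih := continuous_S1_integrable ch.
have h0 : intS1 h = 0.
  rewrite -prim1 (primitive_derivative S1_1 ch cGU dGU) /U prim0 prim1.
  rewrite -(ae_eq_intS1 _ _ u'E); [|exact: integrable_S1_measurable..].
  by rewrite (wderiv1_int0 uu') subrr.
have Guh : ae_eq leb S1 (fun x => G (U 0) + prim h x) (fun x => G (u x)).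
  by apply: (ae_imp _ uU) => x ux Sx; rewrite ux// -hE.
have guh : ae_eq leb S1 h (fun x => g (u x) * u' x).
  by apply: (ae_imp2 _ uU u'E) => x ux u'x Sx; rewrite ux// u'x.
have mu := integrable_S1_measurable iu; have mu' := integrable_S1_measurable iu'.
have i0 : L2 (fun x => G (U 0) + prim h x).
  by apply: L2D; [exact: L2_cst|exact: prim_L2].
have Lh : L2 h.
  have cnh : {within `[0, 1], continuous (fun x => `|h x|)}.
    by move=> x; apply: cvg_norm; exact: ch.
  have [M _ hM] := EVT_max ler01 cnh.
  apply: (L2_le (integrable_S1_measurable ih) (L2_cst `|h M|)).
  by apply: aeW => x Sx; exact: hM.
apply: (wderiv_eq (wderiv1_prim (G (U 0)) ih h0)) => //.
- apply: L2_integrable; apply: ae_eq_L2 Guh i0.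
  apply: measurableT_comp => //; exact: continuous_measurable_fun.
- apply: L2_integrable; apply: ae_eq_L2 guh Lh; apply: measurable_funM => //.
  apply: measurableT_comp => //; exact: continuous_measurable_fun.
Qed.

End chain_rule.

(** * Curves in L^2 and their inner products *)

Section time_dependence.
Context {R : realType}.
Local Notation leb := (@lebesgue_measure R).
Implicit Types (w z : R -> R) (a b : R -> R -> R).

(** The H^k norm as a real number; it agrees with normHk on H^k. *)
Definition real_normHk (k : nat) w : R :=
  Num.sqrt (\sum_(j < k.+1) nrm (wderiv j w) ^+ 2).

Lemma normHkE k w : Hk k w -> normHk k w = (real_normHk k w)%:E.
Proof.
move=> Hw; rewrite /normHk /real_normHk.
rewrite (_ : (\sum_(j < k.+1) _)%E = (\sum_(j < k.+1) nrm (wderiv j w) ^+ 2)%:E) //.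
rewrite -sumEFin; apply: eq_bigr => j _.
rewrite normS1E; first by rewrite expe2 -EFinM -expr2.
by apply: (Hk_L2_wderiv Hw); rewrite -ltnS.
Qed.

Lemma nrm_wderiv_le k j w : (j <= k)%N -> nrm (wderiv j w) <= real_normHk k w.
Proof.
rewrite -ltnS => jk; rewrite -[leLHS]ger0_norm ?nrm_ge0// -sqrtr_sqr.
rewrite ler_sqrt; last by apply: sumr_ge0 => i _; exact: sqr_ge0.
rewrite (bigD1 (Ordinal jk))//= lerDl.
by apply: sumr_ge0 => i _; exact: sqr_ge0.
Qed.

(** Convergence in H^k controls each derivative in L^2.  The derivatives are given
by arbitrary representatives A s, so that linear combinations of representatives
can be used in place of the representative chosen by wderiv. *)
Lemma cvg_nrm_wderiv (F : set_system R) {FF : Filter F} k j (D A : R -> R -> R) :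
  (j <= k)%N -> (\forall s \near F, Hk k (D s) /\ is_wderiv j (D s) (A s)) ->
  normHk k (D s) @[s --> F] --> 0%E -> nrm (A s) @[s --> F] --> 0.
Proof.
move=> jk HD D0.
have r0 : real_normHk k (D s) @[s --> F] --> 0.
  apply: cvg_trans (fine_cvg D0); apply: near_eq_cvg.
  by near=> s; rewrite /= normHkE//; have [] := near HD s.
apply: (@squeeze_cvgr _ _ _ _ (fun=> 0) (fun s => real_normHk k (D s))) => //; last exact: cvg_cst.
near=> s; rewrite nrm_ge0/=.
have [|HDs DA] := near HD s _ => //.
rewrite (@ae_eq_nrm _ (A s) (wderiv j (D s))); first exact: nrm_wderiv_le.
- apply: ae_eq_L2 (Hk_L2_wderiv HDs jk); last exact: wderiv_unique (Hk_wderiv HDs jk) DA.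
  by case: DA => _ /integrable_S1_measurable.
- exact: Hk_L2_wderiv HDs jk.
- exact: wderiv_unique DA (Hk_wderiv HDs jk).
Unshelve. all: by end_near. Qed.

Lemma cvg_ip (F : set_system R) {FF : Filter F} a b w z :
  (\forall s \near F, L2 (a s)) -> (\forall s \near F, L2 (b s)) -> L2 w -> L2 z ->
  nrm (fun x => a s x - w x) @[s --> F] --> 0 ->
  nrm (fun x => b s x - z x) @[s --> F] --> 0 ->
  ip (a s) (b s) @[s --> F] --> ip w z.
Proof.
move=> La Lb Lw Lz a0 b0.
(* <a, b> - <w, z> = <a - w, b - z> + <a - w, z> + <w, b - z> *)
pose d s := nrm (fun x => a s x - w x) * nrm (fun x => b s x - z x) +
  (nrm (fun x => a s x - w x) * nrm z + nrm w * nrm (fun x => b s x - z x)).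
have d0 : d s @[s --> F] --> 0.
  rewrite -[X in _ --> X](_ : 0 * 0 + (0 * nrm z + nrm w * 0) = 0); last by ring.
  apply: cvgD; first exact: cvgM.
  by apply: cvgD; apply: cvgM => //; exact: cvg_cst.
apply/cvgrPdist_lt => e e0.
near=> s; rewrite distrC; have Las : L2 (a s) by near: s. have Lbs : L2 (b s) by near: s.
have La' := L2B Las Lw; have Lb' := L2B Lbs Lz.
have ds : `|d s| < e by rewrite -[d s]subr0 distrC; near: s; exact: cvgr_dist_lt.
apply: le_lt_trans ds.
have -> : ip (a s) (b s) - ip w z = ip (fun x => a s x - w x) (fun x => b s x - z x) +
   (ip (fun x => a s x - w x) z + ip w (fun x => b s x - z x)).
  by rewrite !ipBl// !ipBr//; ring.
rewrite (le_trans _ (ler_norm _))// /d (le_trans (ler_normD _ _))// lerD ?ip_le//.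
by rewrite (le_trans (ler_normD _ _))// lerD ?ip_le.
Unshelve. all: by end_near. Qed.

Definition L2cont (T : R) a : Prop := forall t, 0 <= t <= T ->
  L2 (a t) /\ nrm (fun x => a s x - a t x) @[s --> within `[0, T] (nbhs t)] --> 0.

Definition L2deriv (T : R) a a' : Prop := forall t, 0 <= t <= T ->
  L2 (a' t) /\
  nrm (fun x => (a s x - a t x) / (s - t) - a' t x) @[s --> within `[0, T] t^'] --> 0.

Lemma near_within_itv (T t : R) : \forall s \near within `[0, T] (nbhs t), 0 <= s <= T.
Proof. by rewrite near_withinE; apply: nearW => s /=; rewrite in_itv. Qed.

Lemma near_within_ditv (T t : R) : \forall s \near within `[0, T] t^', 0 <= s <= T /\ s != t.
Proof.
rewrite near_withinE; near=> s => /=; rewrite in_itv/= => ->; split => //.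
by near: s; exact: nbhs_dnbhs_neq.
Unshelve. all: by end_near. Qed.

Lemma cvg_within_dnbhs (A : set R) (t l : R) (g : R -> R) :
  g @ within A (nbhs t) --> l -> g @ within A t^' --> l.
Proof.
move=> h P /h Ph.
by apply: (@filterS _ (nbhs t) _ (fun x => A x -> P (g x)) _ _ Ph) => x Ax _.
Qed.

(** A is a family of j-th weak derivatives of a, with representatives free to be
chosen; j = 0 and A = a gives the continuity of a itself. *)
Lemma C0_Hk_L2cont (T : R) k j a (A : R -> R -> R) : (j <= k)%N -> C0_Hk T k a ->
  (forall t, 0 <= t <= T -> is_wderiv j (a t) (A t) /\ L2 (A t)) -> L2cont T A.
Proof.
move=> jk aT aA t tT; split; first by case: (aA t tT).
have [Hat at0] := aT _ tT; apply: (cvg_nrm_wderiv jk _ at0).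
near=> s; have sT : 0 <= s <= T by near: s; exact: near_within_itv.
split; first by apply: HkB => //; case: (aT _ sT).
by apply: wderivB; [case: (aA s sT)|case: (aA t tT)].
Unshelve. all: by end_near. Qed.

Lemma C1_Hk_L2deriv (T : R) k j a a' (A A' : R -> R -> R) : (j <= k)%N ->
  is_C1_Hk T k a a' ->
  (forall t, 0 <= t <= T -> is_wderiv j (a t) (A t) /\ L2 (A t)) ->
  (forall t, 0 <= t <= T -> is_wderiv j (a' t) (A' t) /\ L2 (A' t)) ->
  L2deriv T A A'.
Proof.
move=> jk [aT a'T da] aA aA' t tT; split; first by case: (aA' t tT).
apply: (cvg_nrm_wderiv jk _ (da t tT)).
near=> s; have [sT st] : 0 <= s <= T /\ s != t by near: s; exact: near_within_ditv.
under eq_fun do rewrite mulrC; under [X in is_wderiv _ _ X]eq_fun do rewrite mulrC.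
split.
  apply: HkB; last by case: (a'T _ tT).
  by apply: HkZ; apply: HkB; [case: (aT _ sT)|case: (aT _ tT)].
apply: wderivB; last by case: (aA' t tT).
by apply: wderivZ; apply: wderivB; [case: (aA s sT)|case: (aA t tT)].
Unshelve. all: by end_near. Qed.

Lemma L2contB (T : R) a b : L2cont T a -> L2cont T b ->
  L2cont T (fun t x => a t x - b t x).
Proof.
move=> aT bT t tT; have [Lat at0] := aT _ tT; have [Lbt bt0] := bT _ tT.
split; first exact: L2B.
apply: (@squeeze_cvgr _ _ _ _ (fun=> 0) (fun s => nrm (fun x => a s x - a t x) +
   nrm (fun x => b s x - b t x))); [|exact: cvg_cst|].
- near=> s; have sT : 0 <= s <= T by near: s; exact: near_within_itv.
  have [Las _] := aT _ sT; have [Lbs _] := bT _ sT.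
  rewrite nrm_ge0/=.
  have -> : nrm (fun x => b s x - b t x) = nrm (fun x => (-1) * (b s x - b t x)).
    by rewrite nrmZ ?normrN1 ?mul1r//; exact: L2B.
  have -> : (fun x => a s x - b s x - (a t x - b t x)) =
     (fun x => (a s x - a t x) + (-1) * (b s x - b t x)).
    by apply/funext => x; ring.
  by apply: nrmD; [exact: L2B|apply: L2Z; exact: L2B].
- by rewrite -[X in _ --> X](addr0 (0 : R)); exact: cvgD.
Unshelve. all: by end_near. Qed.

Lemma L2derivB (T : R) a b a' b' : L2cont T a -> L2cont T b ->
  L2deriv T a a' -> L2deriv T b b' ->
  L2deriv T (fun t x => a t x - b t x) (fun t x => a' t x - b' t x).
Proof.
move=> aT bT da db t tT; have [Lat _] := aT _ tT; have [Lbt _] := bT _ tT.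
have [Lat' at0] := da _ tT; have [Lbt' bt0] := db _ tT.
split; first exact: L2B.
apply: (@squeeze_cvgr _ _ _ _ (fun=> 0) (fun s =>
   nrm (fun x => (a s x - a t x) / (s - t) - a' t x) +
   nrm (fun x => (b s x - b t x) / (s - t) - b' t x))); [|exact: cvg_cst|].
- near=> s; have [sT st] : 0 <= s <= T /\ s != t by near: s; exact: near_within_ditv.
  have [Las _] := aT _ sT; have [Lbs _] := bT _ sT.
  rewrite nrm_ge0/=.
  have LL (c d e : R -> R) : L2 c -> L2 d -> L2 e -> L2 (fun x => (c x - d x) / (s - t) - e x).
    move=> Lc Ld Le; apply: L2B => //; under eq_fun do rewrite mulrC.
    by apply: L2Z; exact: L2B.
  have -> : nrm (fun x => (b s x - b t x) / (s - t) - b' t x) =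
            nrm (fun x => (-1) * ((b s x - b t x) / (s - t) - b' t x)).
    by rewrite nrmZ ?normrN1 ?mul1r//; exact: LL.
  have -> : (fun x => (a s x - b s x - (a t x - b t x)) / (s - t) - (a' t x - b' t x)) =
     (fun x => ((a s x - a t x) / (s - t) - a' t x) +
               (-1) * ((b s x - b t x) / (s - t) - b' t x)).
    by apply/funext => x; ring.
  by apply: nrmD; [exact: LL|apply: L2Z; exact: LL].
- by rewrite -[X in _ --> X](addr0 (0 : R)); exact: cvgD.
Unshelve. all: by end_near. Qed.

Lemma L2cont_cst (T : R) w : L2 w -> L2cont T (fun=> w).
Proof.
move=> Lw t tT; split => //.
rewrite (_ : (fun s => nrm _) = (fun=> 0)); first exact: cvg_cst.
apply/funext => s; rewrite (_ : (fun x => w x - w x) = (fun x => 0 * w x)).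
  by rewrite nrmZ// normr0 mul0r.
by apply/funext => x; rewrite subrr mul0r.
Qed.

Lemma L2deriv_cst (T : R) w : L2deriv T (fun=> w) (fun _ _ => 0).
Proof.
move=> t tT; split; first exact: L2_cst.
rewrite (_ : (fun s => nrm _) = (fun=> 0)); first exact: cvg_cst.
apply/funext => s; rewrite (_ : (fun x => (w x - w x) / (s - t) - 0) = (fun x => 0 * 1)).
  by rewrite nrmZ ?normr0 ?mul0r//; exact: L2_cst.
by apply/funext => x; rewrite subrr !mul0r subr0.
Qed.

Lemma L2cont_ip (T : R) a b : L2cont T a -> L2cont T b ->
  {within `[0, T], continuous (fun s => ip (a s) (b s))}.
Proof.
move=> aT bT; apply/subspace_continuousP => t /=; rewrite in_itv/= => tT.
have [Lat at0] := aT _ tT; have [Lbt bt0] := bT _ tT.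
apply: cvg_ip => //; near=> s; have sT : 0 <= s <= T by near: s; exact: near_within_itv.
- by case: (aT _ sT).
- by case: (bT _ sT).
Unshelve. all: by end_near. Qed.

(** At an interior time the restriction to [0, T] has no effect, and the
quotient by s - t becomes the one by h after the shift s = h + t. *)
Lemma is_derive_diff_quotient (T t l : R) (g : R -> R) : 0 < t < T ->
  (g s - g t) / (s - t) @[s --> within `[0, T] t^'] --> l ->
  is_derive t (1 : R) g l.
Proof.
move=> /andP[t0 tT] gl.
have tr : h + t @[h --> (0 : R)^'] --> within `[0, T] t^'.
  move=> P; rewrite /within/= => -[e /= e0 eP].
  have m0 : 0 < Num.min e (Num.min t (T - t)).
    by rewrite !lt_min e0 t0 subr_gt0.
  exists (Num.min e (Num.min t (T - t))) => // h /=.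
  rewrite sub0r normrN !lt_min => /and3P[he ht hT] h0.
  apply: eP => /=.
  - by rewrite opprD addrCA subrr addr0 normrN.
  - by rewrite -subr_eq0 addrK.
  - rewrite in_itv/=; move: ht hT; rewrite !ltr_norml => /andP[h1 h2] /andP[h3 h4].
    by apply/andP; split; lra.
have := cvg_comp _ _ tr gl => {}gl.
have gl' : h^-1 *: (g (h *: (1 : R) + t) - g t) @[h --> (0 : R)^'] --> l.
  rewrite (_ : (fun h : R => _) = (fun h => (g (h + t) - g t) / (h + t - t)))//.
  by apply/funext => h; rewrite addrK /GRing.scale/= mulr1 mulrC.
apply: DeriveDef; first by apply/cvg_ex; exists l.
exact: (cvg_lim (@norm_hausdorff _ _) gl').
Qed.

(** Leibniz rule: the difference quotient of <a, b> at t is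
< (a_s - a_t) / (s - t), b_s > + < a_t, (b_s - b_t) / (s - t) >. *)
Lemma is_derive_ip (T t : R) a b a' b' : 0 < t < T ->
  L2cont T a -> L2cont T b -> L2deriv T a a' -> L2deriv T b b' ->
  is_derive t (1 : R) (fun s => ip (a s) (b s)) (ip (a' t) (b t) + ip (a t) (b' t)).
Proof.
move=> t0T aT bT da db; apply: (is_derive_diff_quotient t0T).
have tT : 0 <= t <= T by move: t0T => /andP[/ltW -> /ltW ->].
have [Lat _] := aT _ tT; have [Lbt bt0] := bT _ tT.
have [Lat' at0'] := da _ tT; have [Lbt' bt0'] := db _ tT.
have bt0d : nrm (fun x => b s x - b t x) @[s --> within `[0, T] t^'] --> 0.
  exact: cvg_within_dnbhs bt0.
have LL s : 0 <= s <= T -> L2 (fun x => (a s x - a t x) / (s - t)) /\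
    L2 (fun x => (b s x - b t x) / (s - t)).
  move=> sT; split; under eq_fun do rewrite mulrC; apply: L2Z; apply: L2B => //.
  - by case: (aT _ sT).
  - by case: (bT _ sT).
have c1 : ip (fun x => (a s x - a t x) / (s - t)) (b s) @[s --> within `[0, T] t^']
    --> ip (a' t) (b t).
  apply: cvg_ip => //; near=> s; have [sT _] : 0 <= s <= T /\ s != t by near: s; exact: near_within_ditv.
  - by case: (LL _ sT).
  - by case: (bT _ sT).
have c2 : ip (a t) (fun x => (b s x - b t x) / (s - t)) @[s --> within `[0, T] t^']
    --> ip (a t) (b' t).
  apply: cvg_ip => //.
  - by apply: nearW.
  - near=> s; have [sT _] : 0 <= s <= T /\ s != t by near: s; exact: near_within_ditv.
    by case: (LL _ sT).
  - exact: cvg_within_dnbhs (L2cont_cst Lat tT).2.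
apply: cvg_trans (cvgD c1 c2); apply: near_eq_cvg; near=> s.
have [sT _] : 0 <= s <= T /\ s != t by near: s; exact: near_within_ditv.
have [Las _] := aT _ sT; have [Lbs _] := bT _ sT.
have e1 : ip (fun x => (a s x - a t x) / (s - t)) (b s) = (s - t)^-1 * (ip (a s) (b s) - ip (a t) (b s)).
  by rewrite -ipBl// -ipZl//; [congr ip; apply/funext => x; rewrite mulrC|exact: L2B].
have e2 : ip (a t) (fun x => (b s x - b t x) / (s - t)) = (s - t)^-1 * (ip (a t) (b s) - ip (a t) (b t)).
  by rewrite -ipBr// -ipZr//; [congr ip; apply/funext => x; rewrite mulrC|exact: L2B].
by apply: (etrans (congr2 +%R e1 e2)); ring.
Unshelve. all: by end_near. Qed.

End time_dependence.

(** * Sup norms, slices of space-time and bounds on the potential *)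

Section sup_norm.
Context {R : realType}.
Local Notation leb := (@lebesgue_measure R).
Implicit Types (w z : R -> R) (a b : R -> R -> R).

(** When the measure of the whole space is zero the norm is zero by convention,
but then every property holds almost everywhere. *)
Lemma ae_le_Lnorm_oo d (T : measurableType d) (mu : {measure set T -> \bar R}) (f : T -> \bar R) :
  \forall x \ae mu, (`|f x| <= 'N[mu]_+oo[f])%E.
Proof.
rewrite unlock; case: ifPn => [_|]; first exact: ess_sup_ge.
rewrite -leNgt => mu0; apply: measure0_ae.
by apply/eqP; rewrite eq_le mu0/=.
Qed.

Lemma normS1_oo_ge w :
  \forall x \ae leb, S1 x -> (`|w x|%:E <= normS1 +oo w)%E.
Proof.
have := ae_le_Lnorm_oo leb ((EFin \o w) \_ S1); apply: ae_imp => x + Sx.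
by rewrite patchE mem_set.
Qed.

Lemma normS1_oo_le w (M : R) : 0 <= M ->
  (\forall x \ae leb, S1 x -> `|w x| <= M) -> (normS1 +oo w <= M%:E)%E.
Proof.
move=> M0 wM; rewrite /normS1 unlock; case: ifPn => [_|]; last by rewrite lee_fin.
apply/ess_supP; apply: (ae_imp _ wM) => x wx /=; rewrite patchE.
by case: ifPn => [/set_mem/wx|_] /=; rewrite lee_fin// normr0.
Qed.

Lemma normS1_oo_ge0 w : (0 <= normS1 +oo w)%E.
Proof. exact: Lnorm_ge0. Qed.

Lemma normS1_ooE w w' : is_wderiv 1 w w' -> L2 w -> L2 w' ->
  normS1 +oo w = (fine (normS1 +oo w))%:E.
Proof.
move=> ww Lw Lw'; rewrite fineK// ge0_fin_numE ?normS1_oo_ge0//.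
apply: (@le_lt_trans _ _ (nrm w + 2 * nrm w')%:E); last exact: ltry.
apply: normS1_oo_le; last exact: sobolev_sup.
by rewrite addr_ge0 ?mulr_ge0 ?nrm_ge0.
Qed.

(** The sup norm is 1-Lipschitz for itself, hence by the Sobolev embedding it is
Lipschitz for the H^1 norm. *)
Lemma sup_norm_continuous (T : R) a a' : L2cont T a -> L2cont T a' ->
  (forall s, 0 <= s <= T -> is_wderiv 1 (a s) (a' s)) ->
  {within `[0, T], continuous (fun s => fine (normS1 +oo (a s)))}.
Proof.
move=> aT a'T aa'; apply/subspace_continuousP => t /=; rewrite in_itv/= => tT.
have [Lat at0] := aT _ tT; have [Lat' at0'] := a'T _ tT.
have key (w w' z z' : R -> R) : is_wderiv 1 w w' -> is_wderiv 1 z z' -> L2 w -> L2 w' ->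
    L2 z -> L2 z' -> fine (normS1 +oo w) <= fine (normS1 +oo z) +
      (nrm (fun x => w x - z x) + 2 * nrm (fun x => w' x - z' x)).
  move=> ww zz Lw Lw' Lz Lz'.
  rewrite -lee_fin -(normS1_ooE ww)//; apply: normS1_oo_le.
    by rewrite !addr_ge0 ?mulr_ge0 ?nrm_ge0// fine_ge0 ?normS1_oo_ge0.
  have := sobolev_sup (wderivB ww zz) (L2B Lw Lz) (L2B Lw' Lz').
  apply: ae_imp2 (normS1_oo_ge z) => x; rewrite (normS1_ooE zz)// lee_fin => h1 h2 Sx.
  have -> : w x = z x + (w x - z x) by ring.
  by rewrite (le_trans (ler_normD _ _))// lerD ?h1 ?h2.
have nrmBC (w z : R -> R) : L2 w -> L2 z ->
    nrm (fun x => w x - z x) = nrm (fun x => z x - w x).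
  move=> Lw Lz; rewrite -[LHS]mul1r -[X in X * _]normrN1 -nrmZ; last exact: L2B.
  by congr nrm; apply/funext => x; ring.
pose d s := nrm (fun x => a s x - a t x) + 2 * nrm (fun x => a' s x - a' t x).
have d0 : d s @[s --> within `[0, T] (nbhs t)] --> 0.
  rewrite -[X in _ --> X](_ : 0 + 2 * 0 = 0); last by ring.
  by apply: cvgD => //; apply: cvgM => //; exact: cvg_cst.
apply/cvgrPdist_lt => e e0; near=> s; rewrite /from_subspace.
have sT : 0 <= s <= T by near: s; exact: near_within_itv.
have [Las _] := aT _ sT; have [Las' _] := a'T _ sT.
have ds : `|d s| < e by rewrite -[d s]subr0 distrC; near: s; exact: cvgr_dist_lt.
apply: le_lt_trans ds; rewrite (le_trans _ (ler_norm _))//.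
have h1 := key _ _ _ _ (aa' s sT) (aa' t tT) Las Las' Lat Lat'.
have h2 := key _ _ _ _ (aa' t tT) (aa' s sT) Lat Lat' Las Las'.
rewrite (nrmBC (a t) (a s))// (nrmBC (a' t) (a' s))// in h2.
move: h1 h2; rewrite -!/(d s); move: (d s) => D h1 h2.
by rewrite ler_norml; apply/andP; split; lra.
Unshelve. all: by end_near. Qed.

(** By Tonelli a null set of space-time has null slices at almost every time; the
space variable comes first in the product. *)
Lemma ae_slice (P : measurableTypeR R * measurableTypeR R -> Prop) :
  (\forall z \ae (leb \x leb)%E, P z) ->
  \forall s \ae leb, \forall x \ae leb, P (x, s).
Proof.
move=> [A [mA A0 PA]].
have mA2 := measurable_fun_ysection leb mA.
have A2 : (\int[leb]_s (leb \o ysection A) s = 0)%E.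
  have := indic_fubini_tonelli leb leb mA.
  rewrite -indic_fubini_tonelli1// integral_indic// setIT indic_fubini_tonelli_GE// => e.
  by rewrite -[LHS]e; exact: A0.
have : ae_eq leb setT (leb \o ysection A) (cst 0%E).
  apply/ae_eq_integral_abs => //; rewrite -[RHS]A2.
  by apply: eq_integral => s _; rewrite gee0_abs.
apply: ae_imp => s /(_ I) /= As.
exists (ysection A s); split => //; first exact: measurable_ysection.
move=> x /= nP; rewrite /ysection/=; apply/mem_set; exact: PA.
Qed.

Lemma normS1x_oo_slice (I : set R) a (M : R) : (normS1x I +oo a <= M%:E)%E ->
  \forall s \ae leb, I s -> \forall x \ae leb, S1 x -> `|a s x| <= M.
Proof.
move=> aM; have := ae_slice (ae_le_Lnorm_oo (leb \x leb)%E
  ((fun z : R * R => (a z.2 z.1)%:E) \_ (S1 `*` I))).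
apply: ae_imp => s h Is; apply: (ae_imp _ h) => x + Sx; rewrite patchE mem_set//=.
by move=> /le_trans/(_ aM); rewrite lee_fin.
Qed.

Lemma class_C3_continuous (W : R -> R) k : class_C3 W -> (k <= 3)%N -> continuous (derive1n k W).
Proof.
move=> [dW cW]; rewrite leq_eqVlt => /predU1P[->//|k3] x.
by apply: differentiable_continuous; apply/derivable1_diffP; exact: dW.
Qed.

Lemma class_C3_is_derive (W : R -> R) k (x : R) : class_C3 W -> (k < 3)%N ->
  is_derive x (1 : R) (derive1n k W) (derive1n k.+1 W x).
Proof.
by move=> [dW _] k3; rewrite derive1nS derive1E; apply: DeriveDef => //; exact: dW.
Qed.

Lemma normC3_ge (W : R -> R) (M x : R) k : class_C3 W -> (k <= 3)%N ->
  `|x| <= M -> `|derive1n k W x| <= normC3 W M.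
Proof.
move=> W3 k3 xM; have M0 : 0 <= M by rewrite (le_trans _ xM).
have cW : {within `[- M, M], continuous (fun x => `|derive1n k W x|)}.
  by apply: continuous_subspaceT => y; apply: cvg_norm; exact: class_C3_continuous.
have [|c _ hc] := EVT_max _ cW; first by lra.
have xI : x \in `[- M, M] by rewrite in_itv/= -ler_norml.
rewrite /normC3 -[k]/(nat_of_ord (Ordinal (k3 : (k < 4)%N))).
apply: le_trans (le_bigmax _ _ (Ordinal (k3 : (k < 4)%N))).
apply: sup_upper_bound; last by exists x.
split; first by exists `|derive1n k W x|; exists x.
by exists `|derive1n k W c| => _ [y yI <-]; exact: hc.
Qed.

Lemma normC3_ge0 (W : R -> R) (M : R) : 0 <= normC3 W M.
Proof. exact: bigmax_ge_id. Qed.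

(** Mean value theorem for W'', whose derivative W''' is bounded by the C^3 norm. *)
Lemma normC3_lipschitz (W : R -> R) (M x y : R) : class_C3 W -> `|x| <= M -> `|y| <= M ->
  `|derive1n 2 W x - derive1n 2 W y| <= normC3 W M * `|x - y|.
Proof.
move=> W3; wlog xy : x y / x <= y.
  move=> H xM yM; have [xy|/ltW yx] := leP x y; first exact: H.
  by rewrite distrC [`|x - y|]distrC; exact: H.
move=> xM yM; move: xy; rewrite le_eqVlt => /predU1P[->|xy].
  by rewrite !subrr normr0 mulr0.
have cW : {within `[x, y], continuous (derive1n 2 W)}.
  by apply: continuous_subspaceT; exact: class_C3_continuous.
have [c cxy] := MVT xy (fun p _ => @class_C3_is_derive W 2 p W3 erefl) cW.
rewrite distrC [`|x - y|]distrC => ->; rewrite normrM ler_wpM2r//.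
apply: normC3_ge => //; move: cxy xM yM; rewrite in_itv/= !ler_norml.
by move=> /andP[c1 c2] /andP[x1 x2] /andP[y1 y2]; apply/andP; split; lra.
Qed.

End sup_norm.

(** * Gronwall's lemma *)

Section gronwall.
Context {R : realType}.
Local Notation leb := (@lebesgue_measure R).

Lemma prim_within_continuous (f : R -> R) (t : R) : 0 <= t ->
  {within `[0, t], continuous f} -> {within `[0, t], continuous (prim f)}.
Proof.
move=> t0 cf; apply: parameterized_integral_continuous => //.
by apply: continuous_compact_integrable => //; exact: segment_compact.
Qed.

Lemma EFin_prim (f : R -> R) (t : R) : {within `[0, t], continuous f} ->
  (\int[leb]_(s in `[0%R, t]) (f s)%:E)%E = (prim f t)%:E.
Proof.
move=> cf; rewrite /prim /Rintegral fineK//; apply: integrable_fin_num => //.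
by apply: continuous_compact_integrable => //; exact: segment_compact.
Qed.

(** With phi = exp (- int k), the derivative of phi y is phi (y' - k y), which is
at most rho at almost every time because phi <= 1 and rho >= 0.  The left-hand
side is continuous, so the fundamental theorem of calculus applies to it, while
rho is only measurable and possibly of infinite integral. *)
Lemma gronwall (t : R) (y y' k : R -> R) (rho : R -> \bar R) : 0 < t ->
  {within `[0, t], continuous y} -> {within `[0, t], continuous y'} ->
  {within `[0, t], continuous k} -> (forall s, 0 <= k s) ->
  (forall s, 0 < s < t -> is_derive s (1 : R) y (y' s)) ->
  measurable_fun (`]0, t[ : set (measurableTypeR R)) rho ->
  (forall s, (0 <= rho s)%E) ->
  (\forall s \ae leb, `]0, t[%classic s -> ((y' s - k s * y s)%:E <= rho s)%E) ->
  ((y t)%:E <= ((y 0)%:E + \int[leb]_(s in `]0%R, t[) rho s) *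
     expeR (\int[leb]_(s in `[0%R, t]) (k s)%:E))%E.
Proof.
move=> t0 cy cy' ck k0 dy mrho rho0 yrho.
have t0' := ltW t0.
have cP := prim_within_continuous t0' ck.
pose phi s := expR (- prim k s).
have cphi : {within `[0, t], continuous phi}.
  by move=> s; apply: continuous_comp; [apply: cvgN; exact: cP|exact: continuous_expR].
pose psi s := phi s * y s; pose psi' s := phi s * (y' s - k s * y s).
have cpsi : {within `[0, t], continuous psi} by move=> s; apply: cvgM; [exact: cphi|exact: cy].
have cpsi' : {within `[0, t], continuous psi'}.
  move=> s; apply: cvgM; first exact: cphi.
  by apply: cvgB; [exact: cy'|apply: cvgM; [exact: ck|exact: cy]].
have dpsi (s : R) : 0 < s < t -> is_derive s (1 : R) psi (psi' s).
  move=> st; have dP := is_derive_prim ck st.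
  have dN := @is_deriveN _ _ _ _ _ _ _ dP.
  have dphi := @is_derive1_comp _ (@expR R) (fun s => - prim k s) s _ _ (is_derive_expR _) dN.
  apply: (is_derive_eq (is_deriveM dphi (dy s st))).
  by rewrite /psi' /phi /GRing.scale/=; ring.
have ftc : (\int[leb]_(s in `[0%R, t]) (psi' s)%:E = (psi t)%:E - (psi 0)%:E)%E.
  have [_ psir psil] := (continuous_within_itvP _ t0).1 cpsi.
  apply: continuous_FTC2 => //.
  - split => // s; rewrite in_itv/= => st; apply: ex_derive; exact: dpsi.
  - by move=> s; rewrite in_itv/= => st; rewrite derive1E; have /@derive_val := dpsi s st.
have psi0 : psi 0 = y 0 by rewrite /psi /phi prim0 oppr0 expR0 mul1r.
have ipsi' : leb.-integrable `[0, t] (EFin \o psi').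
  by apply: continuous_compact_integrable => //; exact: segment_compact.
have mpsi' : measurable_fun (`[0, t] : set (measurableTypeR R)) psi'.
  by apply/measurable_EFinP; exact: measurable_int ipsi'.
have phi1 s : 0 <= phi s <= 1.
  by rewrite expR_ge0/= expR_le1 oppr_le0; apply: Rintegral_ge0 => r _; exact: k0.
have le1 : (\int[leb]_(s in `[0%R, t]) (psi' s)%:E <= \int[leb]_(s in `]0%R, t[) rho s)%E.
  have imax : leb.-integrable `[0, t] (EFin \o (fun s => Num.max (psi' s) 0)).
    by have := integrable_funrpos _ ipsi'; apply.
  have mmax := measurable_int _ imax.
  (* The positive part is compared with rho by the a.e. monotonicity of the
     integral of nonnegative functions. *)
  apply: (@le_trans _ _ (\int[leb]_(s in `[0%R, t]) (Num.max (psi' s) 0)%:E)%E).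
    by apply: le_integral => // s _; rewrite lee_fin le_max lexx.
  have sub1 : `[0, t[ `<=` `[0, t] by apply: subset_itvl; rewrite bnd_simp.
  have sub2 : `]0, t[ `<=` `[0, t] by apply: subset_itv; rewrite bnd_simp.
  rewrite -integral_itv_bndo_bndc; last first.
    by apply: measurable_funS mmax.
  rewrite -integral_itv_obnd_cbnd; last first.
    by apply: measurable_funS mmax.
  apply: ae_ge0_le_integral => //.
  - by move=> s _; rewrite lee_fin le_max lexx orbT.
  - by exact: measurable_funS mmax.
  - apply: (ae_imp _ yrho) => s + st => /(_ st) h; have /andP[p0 p1] := phi1 s.
    rewrite /psi'; have [z|/ltW z] := leP (y' s - k s * y s) 0.
      by rewrite max_r ?rho0// mulr_ge0_le0.
    rewrite max_l ?mulr_ge0//; apply: le_trans h; rewrite lee_fin.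
    by rewrite ler_piMl.
have e1 : y t = psi t * expR (prim k t).
  by rewrite /psi /phi mulrAC -expRD addNr expR0 mul1r.
rewrite (EFin_prim ck) /= e1 EFinM lee_wpmul2r ?lee_fin ?expR_ge0//.
by rewrite -psi0 -leeBlDl -?ftc.
Qed.
End gronwall.

(** * The space-time L^2 norm as an iterated integral *)

Section space_time.
Context {R : realType}.
Local Notation leb := (@lebesgue_measure R).
Implicit Type a : R -> R -> R.

Definition space_time_sqr (I : set R) a (z : measurableTypeR R * measurableTypeR R) : \bar R :=
  ((fun z : R * R => (a z.2 z.1 ^+ 2)%:E) \_ (S1 `*` I)) z.

(** The measurability hypothesis is stated for the default product structure on
R * R; it is read here in the product of the carriers of Lebesgue measure. *)
Lemma measurable_space_time_sqr (I : set (measurableTypeR R)) a : measurable I ->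
  measurableS1x I a -> measurable_fun setT (space_time_sqr I a).
Proof.
move=> mI ma.
have mD : measurable (S1 `*` I : set (measurableTypeR R * measurableTypeR R)).
  by apply: measurableX => //; exact: measurable_S1.
(* The two product sigma-algebras are convertible. *)
have ma' : measurable_fun (S1 `*` I : set (measurableTypeR R * measurableTypeR R))
    (fun z => a z.2 z.1) := ma.
apply: (measurable_restrictT _ mD).1.
by apply/measurable_EFinP; exact: measurable_funX.
Qed.

Lemma space_time_sqrE (I : set R) a (s : R) : I s ->
  (\int[leb]_x space_time_sqr I a (x, s) = normS1 2%:E (a s) ^+ 2)%E.
Proof.
move=> Is; rewrite normS1_sqr [RHS]integral_mkcond; apply: eq_integral => x _.
rewrite /space_time_sqr !patchE/=; case: ifPn => [/set_mem[Sx _]|nx].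
  by rewrite mem_set.
rewrite ifF//; apply/negbTE; apply: contra nx => /set_mem Sx.
exact: mem_set.
Qed.

Lemma normS1x_sqr (I : set (measurableTypeR R)) a : measurable I -> measurableS1x I a ->
  measurable_fun I (fun s => (normS1 2%:E (a s) ^+ 2)%E) /\
  (normS1x I 2%:E a ^+ 2 = \int[leb]_(s in I) (normS1 2%:E (a s) ^+ 2)%E)%E.
Proof.
move=> mI ma; have mh := measurable_space_time_sqr mI ma.
have h0 z : (0 <= space_time_sqr I a z)%E.
  by rewrite /space_time_sqr patchE; case: ifPn => // _; rewrite lee_fin sqr_ge0.
split.
  apply: (eq_measurable_fun (fubini_G leb (space_time_sqr I a))).
    by move=> s /set_mem Is; exact: space_time_sqrE.
  apply: measurable_funTS.
  by apply: (measurable_fun_fubini_tonelli_G (m1 := leb) (space_time_sqr I a)).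
have i0 : (0 <= \int[leb \x leb]_z (`|((fun z : R * R => (a z.2 z.1)%:E) \_ (S1 `*` I)) z| `^ 2))%E.
  by apply: integral_ge0 => z _; exact: poweR_ge0.
rewrite /normS1x unlock poweR12_sqrt// sqr_sqrte//.
rewrite (eq_integral (space_time_sqr I a)); last first.
  move=> z _; rewrite /space_time_sqr !patchE; case: ifPn => _ /=; last by rewrite normr0 powR0.
  by rewrite powR_mulrn// real_normK// num_real.
rewrite (fubini_tonelli2 (m1 := leb) (m2 := leb) _ mh h0) [RHS]integral_mkcond.
apply: eq_integral => s _; rewrite patchE; case: ifPn => [/set_mem Is|nI].
  exact: space_time_sqrE.
rewrite /fubini_G integral0_eq// => x _; rewrite /space_time_sqr patchE ifF//.
by apply/negbTE; apply: contra nI => /set_mem[_ ?]; exact/mem_set.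
Qed.

Lemma measurableS1x_slice (I : set R) a (s : R) : measurable (I : set (measurableTypeR R)) ->
  measurableS1x I a -> I s -> meas_S1 (a s).
Proof.
move=> mI ma Is.
have mD : measurable (S1 `*` I : set (measurableTypeR R * measurableTypeR R)).
  by apply: measurableX => //; exact: measurable_S1.
have ma' : measurable_fun (S1 `*` I : set (measurableTypeR R * measurableTypeR R))
    (fun z => a z.2 z.1) := ma.
have /(measurable_restrictT _ mD) mp := ma'.
have := measurableT_comp mp (measurable_pair2 s) => h.
apply: (eq_measurable_fun _ _ (measurable_funTS h)).
by move=> x /set_mem Sx /=; rewrite patchE mem_set.
Qed.

End space_time.

(** * The energy balance and the estimate of the stress *)

Section energy.
Context {R : realType}.
Local Notation leb := (@lebesgue_measure R).
Implicit Types (W : R -> R) (u v a : R -> R -> R).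

Lemma path_L2cont (T : R) k j u : C0_Hk T k u -> (j <= k)%N ->
  L2cont T (fun s => wderiv j (u s)).
Proof.
move=> uT jk; apply: (C0_Hk_L2cont jk uT) => t tT; have [Hu _] := uT _ tT.
by split; [exact: Hk_wderiv Hu jk|exact: Hk_L2_wderiv Hu jk].
Qed.

Lemma path_L2cont0 (T : R) k u : C0_Hk T k u -> L2cont T u.
Proof.
move=> uT; apply: (C0_Hk_L2cont (leq0n k) uT) => t tT; have [[Lu _] _] := uT _ tT.
by split => //; apply: wderiv0; exact: L2_integrable.
Qed.

Lemma path_wderiv (T : R) k j u : C0_Hk T k u -> (j < k)%N ->
  forall s, 0 <= s <= T -> is_wderiv 1 (wderiv j (u s)) (wderiv j.+1 (u s)).
Proof.
move=> uT jk s sT; have [Hu _] := uT _ sT.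
exact: wderiv_next (Hk_wderiv Hu (ltnW jk)) (Hk_wderiv Hu jk).
Qed.

Lemma path_wderiv1 (T : R) k u : C0_Hk T k u -> (0 < k)%N ->
  forall s, 0 <= s <= T -> is_wderiv 1 (u s) (wderiv 1 (u s)).
Proof. by move=> uT k0 s sT; have [Hu _] := uT _ sT; exact: Hk_wderiv Hu k0. Qed.

Lemma path_L2deriv (T : R) k j u ut : is_C1_Hk T k u ut -> (j <= k)%N ->
  L2deriv T (fun s => wderiv j (u s)) (fun s => wderiv j (ut s)).
Proof.
move=> /[dup] uC [uT utT _] jk; apply: (C1_Hk_L2deriv jk uC) => t tT.
  have [Hu _] := uT _ tT.
  by split; [exact: Hk_wderiv Hu jk|exact: Hk_L2_wderiv Hu jk].
have [Hu _] := utT _ tT.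
by split; [exact: Hk_wderiv Hu jk|exact: Hk_L2_wderiv Hu jk].
Qed.

Lemma path_L2deriv0 (T : R) k u ut : is_C1_Hk T k u ut -> L2deriv T u ut.
Proof.
move=> /[dup] uC [uT utT _]; apply: (C1_Hk_L2deriv (leq0n k) uC) => t tT.
  have [[Lu _] _] := uT _ tT.
  by split => //; apply: wderiv0; exact: L2_integrable.
have [[Lu _] _] := utT _ tT.
by split => //; apply: wderiv0; exact: L2_integrable.
Qed.

(** The mean is the inner product with the constant 1, so it is continuous in time
with derivative the mean of a', which is zero. *)
Lemma mean_zero (T : R) a a' : L2cont T a -> L2deriv T a a' ->
  (forall s, 0 < s < T -> intS1 (a' s) = 0) -> ae_eq leb S1 (a 0) (fun=> 0) ->
  forall t, 0 <= t <= T -> intS1 (a t) = 0.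
Proof.
move=> aT da a'0 a0 t /andP[t0 tT].
have T0 : 0 <= (0 : R) <= T by rewrite lexx (le_trans t0).
have ip1 (w : R -> R) : ip w (fun=> 1) = intS1 w.
  by apply: eq_intS1 => x _; rewrite mulr1.
have e0 : intS1 (a 0) = 0.
  rewrite -[RHS](intS1_cst (0 : R)); apply: ae_eq_intS1 => //.
    by case: (aT _ T0) => /L2_measurable.
  exact: measurable_cst.
move: t0; rewrite le_eqVlt => /predU1P[<-//|t0].
have L1 := @L2cont_cst R T _ (L2_cst 1).
have c1 := L2cont_ip aT L1.
have ct : {within `[0, t], continuous (fun s => ip (a s) (fun=> 1))}.
  by apply: continuous_subspaceW c1; apply: subset_itvl; rewrite bnd_simp.
have dt (s : R) : s \in `]0, t[ -> is_derive s (1 : R) (fun s => ip (a s) (fun=> 1)) 0.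
  rewrite in_itv/= => /andP[s0 st].
  have sT : 0 < s < T by rewrite s0 (lt_le_trans st).
  apply: (is_derive_eq (is_derive_ip sT aT L1 da (@L2deriv_cst R T (fun=> 1)))).
  rewrite ip1 a'0// add0r -[RHS](intS1_cst (0 : R)).
  by apply: eq_intS1 => x _; rewrite mulr0.
have [c _] := MVT t0 dt ct; rewrite mul0r !ip1 e0 subr0 => ->//.
Qed.

(** Integrating by parts, <f, - gamma exxx> = gamma <fx, exx> and
gamma <ex, ex'> = gamma <ex, fxx> = - gamma <exx, fx>: the dispersive terms
cancel, and <f, mu fxx> is the dissipation - mu |fx|^2. *)
Lemma energy_rate (gamma mu : R) (f f' fx fxx ex ex' exx exxx q r : R -> R) :
  L2 f -> L2 f' -> L2 fx -> L2 fxx -> L2 ex -> L2 ex' -> L2 exx -> L2 exxx -> L2 q -> L2 r ->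
  is_wderiv 1 f fx -> is_wderiv 1 fx fxx -> is_wderiv 1 ex exx -> is_wderiv 1 exx exxx ->
  ae_eq leb S1 f' (fun x => q x + (mu * fxx x - gamma * exxx x) - r x) ->
  ae_eq leb S1 ex' fxx ->
  ip f f' + gamma * ip ex ex' = ip f q - mu * ip fx fx - ip f r.
Proof.
move=> Lf Lf' Lfx Lfxx Lex Lex' Lexx Lexxx Lq Lr df dfx dex dexx fE exE.
have Lm := L2Z mu Lfxx; have Lg := L2Z gamma Lexxx.
have Lmg := L2B Lm Lg; have Lqm := L2D Lq Lmg.
rewrite (ae_eq_ip Lf Lf' Lf (L2B Lqm Lr) (ae_eq_refl _ _ _) fE).
rewrite (ae_eq_ip Lex Lex' Lex Lfxx (ae_eq_refl _ _ _) exE).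
rewrite ipBr// ipDr// ipBr// !ipZr//.
rewrite (ip_by_parts df dfx)// (ip_by_parts df dexx)// (ip_by_parts dex dfx)//.
by rewrite [ip exx fx]ipC; ring.
Qed.

(** p a - p' a' = p (a - a') + (p - p') a', and the square of a sum is at most twice
the sum of the squares. *)
Lemma stress_pointwise (b N p p' a a' d : R) : 0 <= b -> 0 <= N ->
  `|p| <= b -> `|p - p'| <= b * `|d| -> `|a'| <= N ->
  (p * a - p' * a') * (p * a - p' * a') <=
  2 * b ^+ 2 * ((a - a') * (a - a') + N ^+ 2 * (d * d)).
Proof.
move=> b0 N0 pb ppb aN.
have h1 : `|p * (a - a')| <= b * `|a - a'| by rewrite normrM ler_wpM2r.
have h2 : `|(p - p') * a'| <= b * (N * `|d|).
  by rewrite normrM (le_trans (ler_pM _ _ ppb aN))// [N * _]mulrC mulrA.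
have sq1 : `|p * (a - a')| ^+ 2 <= (b * `|a - a'|) ^+ 2.
  by rewrite lerXn2r// nnegrE mulr_ge0.
have sq2 : `|(p - p') * a'| ^+ 2 <= (b * (N * `|d|)) ^+ 2.
  by rewrite lerXn2r// nnegrE !mulr_ge0.
move: sq1 sq2; rewrite !exprMn !real_normK ?num_real// => sq1 sq2.
have := sqr_ge0 (p * (a - a') - (p - p') * a').
have -> : p * a - p' * a' = p * (a - a') + (p - p') * a' by ring.
move: sq1 sq2; move: (p * (a - a')) ((p - p') * a') => A B sq1 sq2 AB.
rewrite -!expr2 mulrDr.
have -> : 2 * b ^+ 2 * (N ^+ 2 * d ^+ 2) = 2 * (b ^+ 2 * (N ^+ 2 * d ^+ 2)) by ring.
rewrite -mulrA; move: sq1 sq2 AB; move: (b ^+ 2 * (a - a') ^+ 2) (b ^+ 2 * (N ^+ 2 * d ^+ 2)) => X Y.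
move=> sq1 sq2 AB; lra.
Qed.

(** stress_pointwise with p, p' the values of W'' at u and uh, integrated over the
circle; the Poincare inequality then absorbs the term in u - uh. *)
Lemma stress_bound W (M N CP : R) (u uh ux uhx q : R -> R) : class_C3 W ->
  L2 u -> L2 uh -> L2 ux -> L2 uhx -> L2 q -> 0 <= N ->
  (\forall x \ae leb, S1 x -> `|u x| <= M) ->
  (\forall x \ae leb, S1 x -> `|uh x| <= M) ->
  (\forall x \ae leb, S1 x -> `|uhx x| <= N) ->
  ae_eq leb S1 q (fun x => derive1n 2 W (u x) * ux x - derive1n 2 W (uh x) * uhx x) ->
  nrm (fun x => u x - uh x) <= CP * nrm (fun x => ux x - uhx x) ->
  ip q q <= 2 * normC3 W M ^+ 2 * (1 + CP ^+ 2 * N ^+ 2) *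
    ip (fun x => ux x - uhx x) (fun x => ux x - uhx x).
Proof.
move=> W3 Lu Luh Lux Luhx Lq N0 uM uhM uhxN qE eCP.
have b0 := normC3_ge0 W M.
have Le := L2B Lu Luh; have Lex := L2B Lux Luhx.
set e := (fun x => u x - uh x) in Le eCP *; set ex := (fun x => ux x - uhx x) in Lex eCP *.
have e2 : ip e e <= CP ^+ 2 * ip ex ex.
  rewrite -!sqr_nrm -exprMn lerXn2r// nnegrE ?nrm_ge0//.
  exact: le_trans (nrm_ge0 _) eCP.
apply: (@le_trans _ _ (2 * normC3 W M ^+ 2 * (ip ex ex + N ^+ 2 * ip e e))); last first.
  rewrite -mulrA [X in _ <= X](_ : _ = 2 * normC3 W M ^+ 2 * (ip ex ex + N ^+ 2 * (CP ^+ 2 * ip ex ex))); last by ring.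
  rewrite -mulrA ler_wpM2l// ler_wpM2l ?sqr_ge0// lerD2l ler_wpM2l ?sqr_ge0//.
have i1 := L2_mul Lex Lex; have i2 := L2_mul Le Le.
have i3 := integrable_S1Z (N ^+ 2) i2.
rewrite /ip -[X in _ * (_ + X)]intS1Z// -intS1D// -intS1Z; last exact: integrable_S1D.
apply: le_intS1; [exact: L2_mul|exact/integrable_S1Z/integrable_S1D|].
have h := ae_imp2 (fun x => @pair _ _) uM uhM.
have h' := ae_imp2 (fun x => @pair _ _) uhxN qE.
apply: (ae_imp2 _ h h') => x [hM1 hM2] [hN hq] Sx.
have {}hM1 := hM1 Sx; have {}hM2 := hM2 Sx.
have {}hN := hN Sx; rewrite hq//.
have l2 := normC3_lipschitz W3 hM1 hM2.
have l1 := normC3_ge W3 (erefl : (2 <= 3)%N) hM1.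
exact: (stress_pointwise (ux x) b0 N0 l1 l2 hN).
Qed.

End energy.

(** * The relative entropy and its growth rate *)

Section relative_entropy.
Context {R : realType}.
Local Notation leb := (@lebesgue_measure R).
Implicit Types (W : R -> R) (u v uh vh Res : R -> R -> R).

Definition err0 v vh (s : R) : R -> R := fun x => v s x - vh s x.
Definition err (j : nat) u uh (s : R) : R -> R :=
  fun x => wderiv j (u s) x - wderiv j (uh s) x.

(** The part of the reduced relative entropy without time integral. *)
Definition rel_energy (gamma : R) u v uh vh (s : R) : R :=
  2^-1 * (ip (err0 v vh s) (err0 v vh s) + gamma * ip (err 1 u uh s) (err 1 u uh s)).

Definition dissipation v vh (s : R) : R := ip (err 1 v vh s) (err 1 v vh s).

Lemma dissipation_continuous (T : R) k v vh : (0 < k)%N -> C0_Hk T k v -> C0_Hk T k vh ->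
  {within `[0, T], continuous (dissipation v vh)}.
Proof.
move=> k0 vT vhT; have c1 : L2cont T (err 1 v vh).
  exact: (L2contB (path_L2cont vT k0) (path_L2cont vhT k0)).
exact: L2cont_ip.
Qed.

Lemma etaRE (gamma mu T t : R) u v uh vh : 0 <= t <= T ->
  C0_Hk T 3 u -> C0_Hk T 3 uh -> C0_Hk T 2 v -> C0_Hk T 2 vh ->
  etaR gamma mu u v uh vh t =
  (rel_energy gamma u v uh vh t + mu / 4 * prim (dissipation v vh) t)%:E.
Proof.
move=> tT uT uhT vT vhT; have /andP[t0 tT'] := tT.
have Lf : L2 (err0 v vh t).
  by apply: L2B; [case: (path_L2cont0 vT tT)|case: (path_L2cont0 vhT tT)].
have Lex : L2 (err 1 u uh t).
  apply: L2B; [case: (path_L2cont uT (isT : (1 <= 3)%N) tT)|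
               case: (path_L2cont uhT (isT : (1 <= 3)%N) tT)] => //.
have i1 : integrable_S1 (fun x => (v t x - vh t x) ^+ 2 +
    gamma * (wderiv 1 (u t) x - wderiv 1 (uh t) x) ^+ 2).
  by apply: integrable_S1D; [exact: (L2_sqr Lf)|exact: (integrable_S1Z gamma (L2_sqr Lex))].
rewrite /etaR EFinD; congr (_ + _)%E.
  rewrite (EFin_intS1 i1) -EFinM; congr (_ * _)%:E.
  rewrite (intS1D (L2_sqr Lf) (integrable_S1Z gamma (L2_sqr Lex))).
  by rewrite (intS1Z gamma (L2_sqr Lex)).
rewrite [RHS]EFinM; congr (_ * _)%E.
have cd := dissipation_continuous (isT : (0 < 2)%N) vT vhT.
rewrite -EFin_prim; last first.
  by apply: continuous_subspaceW cd; apply: subset_itvl; rewrite bnd_simp.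
apply: eq_integral => s /set_mem; rewrite /= in_itv/= => /andP[s0 st].
have sT : 0 <= s <= T by rewrite s0 (le_trans st).
have dv := path_wderiv1 vT (isT : (0 < 2)%N) sT.
have dvh := path_wderiv1 vhT (isT : (0 < 2)%N) sT.
have [Lv _] := path_L2cont vT (isT : (1 <= 2)%N) sT.
have [Lvh _] := path_L2cont vhT (isT : (1 <= 2)%N) sT.
have dd := wderivB dv dvh; have Ld := L2B Lv Lvh.
have Lw := L2_wderiv dd Ld.
rewrite /seminormH1 (normS1E Lw) -EFinM -expr2; congr (_ %:E).
rewrite (ae_eq_nrm Lw Ld); first by rewrite sqr_nrm.
exact: wderiv_unique (wderivP (ex_intro _ _ dd)) dd.
Qed.

(** K as a real function of N, the sup norm of the space derivative of uh. *)
Definition growth (gamma CP Wb N : R) : R :=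
  Num.max (2 * CP ^+ 2 * Wb ^+ 2 / gamma * N ^+ 2 + 2 * Wb ^+ 2 / gamma) (3 / 2).

Lemma KE (gamma CP Wb T s : R) uh : 0 <= s <= T -> C0_Hk T 3 uh ->
  K gamma CP Wb uh s = (growth gamma CP Wb (fine (normS1 +oo (wderiv 1 (uh s)))))%:E.
Proof.
move=> sT uhT; have d1 := path_wderiv uhT (isT : (1 < 3)%N) sT.
have [L1 _] := path_L2cont uhT (isT : (1 <= 3)%N) sT.
have [L2' _] := path_L2cont uhT (isT : (2 <= 3)%N) sT.
rewrite /K (normS1_ooE d1 L1 L2') /growth EFin_max; congr (maxe _ _).
Qed.

Lemma growth_ge0 (gamma CP Wb N : R) : 0 <= growth gamma CP Wb N.
Proof. by rewrite le_max; apply/orP; right; lra. Qed.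

Lemma growth_continuous (gamma CP Wb T : R) uh : C0_Hk T 3 uh ->
  {within `[0, T], continuous
    (fun s => growth gamma CP Wb (fine (normS1 +oo (wderiv 1 (uh s)))))}.
Proof.
move=> uhT.
have cN := sup_norm_continuous (path_L2cont uhT (isT : (1 <= 3)%N))
  (path_L2cont uhT (isT : (2 <= 3)%N)) (path_wderiv uhT (isT : (1 < 3)%N)).
move=> s; apply: (continuous_comp (cN s)).
apply: continuous_max; last exact: cvg_cst.
apply: cvgD; last exact: cvg_cst.
by apply: cvgM; [exact: cvg_cst|exact: exprn_continuous].
Qed.

(** The scalar inequality behind d eta/dt - K eta <= |Res|^2.  Here ff, ee, cc, rr
stand for the squared norms of f, e_x, f_x and the residual, fq and fr for the
inner products of f with the stress difference and the residual, and P for the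
time integral of cc.  The terms in cc have the right sign since 1/4 of the
dissipation is spent on eta_R. *)
Lemma rate_bound (gamma mu CP b N ff ee rr fq fr cc D P : R) : 0 < gamma -> 0 <= mu ->
  0 <= ff -> 0 <= ee -> 0 <= cc -> 0 <= P ->
  fq <= 2^-1 * ff + b ^+ 2 * (1 + CP ^+ 2 * N ^+ 2) * ee ->
  - fr <= 4^-1 * ff + rr ->
  D = fq - mu * cc - fr ->
  D + mu / 4 * cc - growth gamma CP b N * (2^-1 * (ff + gamma * ee) + mu / 4 * P) <= rr.
Proof.
move=> g0 mu0 ff0 ee0 cc0 P0 fqb frb ->.
have k0 := growth_ge0 gamma CP b N.
have k1 : 3 / 2 <= growth gamma CP b N by rewrite le_max lexx orbT.
have k2 : b ^+ 2 * (1 + CP ^+ 2 * N ^+ 2) * 2 <= growth gamma CP b N * gamma.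
  apply: (@le_trans _ _ ((2 * CP ^+ 2 * b ^+ 2 / gamma * N ^+ 2 + 2 * b ^+ 2 / gamma) * gamma)).
    have -> : (2 * CP ^+ 2 * b ^+ 2 / gamma * N ^+ 2 + 2 * b ^+ 2 / gamma) * gamma =
       b ^+ 2 * (1 + CP ^+ 2 * N ^+ 2) * 2 by field; rewrite gt_eqF.
    exact: lexx.
  by rewrite ler_wpM2r ?(ltW g0)// le_max lexx.
move: k0 k1 k2 fqb; set k := growth _ _ _ _; set B := b ^+ 2 * _ => k0 k1 k2 fqb.
have h1 : 3 / 2 * ff <= k * ff by rewrite ler_wpM2r.
have h2 : B * 2 * ee <= k * gamma * ee by rewrite ler_wpM2r.
have h3 : 0 <= mu * cc by rewrite mulr_ge0.
have h4 : 0 <= k * (mu / 4 * P) by rewrite !mulr_ge0.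
have -> : k * (2^-1 * (ff + gamma * ee) + mu / 4 * P) =
  2^-1 * (k * ff) + 2^-1 * (k * gamma * ee) + k * (mu / 4 * P) by ring.
lra.
Qed.

Lemma poincare_nrm (CP : R) (w w' : R -> R) : poincare_constant CP ->
  is_wderiv 1 w w' -> L2 w -> L2 w' -> intS1 w = 0 -> nrm w <= CP * nrm w'.
Proof.
move=> HCP ww Lw Lw' w0.
have Hw : Hk 1 w.
  split => // -[_|[_|//]]; last by exists w'.
  by exists w => //; apply: wderiv0; exact: L2_integrable.
have := HCP w Hw w0; have Lw1 := L2_wderiv ww Lw'.
rewrite /seminormH1 (normS1E Lw) (normS1E Lw1) -EFinM lee_fin.
have e : is_wderiv 1 w (wderiv 1 w) := wderivP (ex_intro _ _ ww).
by rewrite (ae_eq_nrm Lw1 Lw' (wderiv_unique e ww)).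
Qed.

(** Expand |2 a f - g|^2 >= 0. *)
Lemma ip_young (a : R) (f g : R -> R) : 0 < a -> L2 f -> L2 g ->
  ip f g <= a * ip f f + (4 * a)^-1 * ip g g.
Proof.
move=> a0 Lf Lg; have := ip_ge0 (fun x => (2 * a) * f x - g x).
have L1 := L2Z (2 * a) Lf; have L2' := L2B L1 Lg.
rewrite ipBr// !ipBl// !ipZr// !ipZl// [ip g f]ipC => h.
have a4 : 0 < 4 * a by rewrite mulr_gt0.
rewrite -subr_ge0 -(pmulr_rge0 _ a4).
have -> : 4 * a * (a * ip f f + (4 * a)^-1 * ip g g - ip f g) =
  2 * a * (2 * a * ip f f) - 2 * a * ip f g - (2 * a * ip f g - ip g g).
  by field; rewrite gt_eqF.
exact: h.
Qed.

End relative_entropy.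

(** * The bound on the reduced relative entropy *)

Section entropy_bound.
Context {R : realType}.
Local Notation leb := (@lebesgue_measure R).
Implicit Types (W : R -> R) (u v uh vh Res : R -> R -> R).
Local Open Scope ring_scope.

(** Chain rule for W', which is C^2; u has the two weak derivatives it requires. *)
Lemma stress_wderiv W (T s : R) u : class_C3 W -> C0_Hk T 3 u -> 0 <= s <= T ->
  is_wderiv 1 (fun x => derive1 W (u s x))
    (fun x => derive1n 2 W (u s x) * wderiv 1 (u s) x).
Proof.
move=> W3 uT sT.
apply: (wderiv1_comp (G := derive1n 1 W)).
- by move=> x; exact: (@class_C3_is_derive R W 1 x W3 isT).
- exact: class_C3_continuous.
- exact: (path_wderiv1 uT (isT : (0 < 3)%N) sT).
- exact: (path_wderiv uT (isT : (1 < 3)%N) sT).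
Qed.

Lemma etaR_ge0 (gamma mu t : R) u v uh vh : 0 <= gamma -> 0 <= mu ->
  (0 <= etaR gamma mu u v uh vh t)%E.
Proof.
move=> g0 mu0; apply: adde_ge0; apply: mule_ge0; rewrite ?lee_fin//.
- apply: integral_ge0 => x _; rewrite lee_fin.
  by apply: addr_ge0; [exact: sqr_ge0|apply: mulr_ge0 => //; exact: sqr_ge0].
- by rewrite divr_ge0.
- by apply: integral_ge0 => s _; apply: expe_ge0; exact: Lnorm_ge0.
Qed.

Lemma Mbar_slice u uh : (Mbar u uh < +oo)%E ->
  \forall s \ae leb, 0 < s ->
    (\forall x \ae leb, S1 x -> `|u s x| <= fine (Mbar u uh)) /\
    (\forall x \ae leb, S1 x -> `|uh s x| <= fine (Mbar u uh)).
Proof.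
move=> Mfin.
have ME : (Mbar u uh = (fine (Mbar u uh))%:E)%E.
  by rewrite fineK// ge0_fin_numE// /Mbar le_max Lnorm_ge0.
have uM : (normS1x `]0%R, +oo[ +oo u <= (fine (Mbar u uh))%:E)%E.
  by rewrite -ME /Mbar le_max lexx.
have uhM : (normS1x `]0%R, +oo[ +oo uh <= (fine (Mbar u uh))%:E)%E.
  by rewrite -ME /Mbar le_max lexx orbT.
apply: (ae_imp2 _ (normS1x_oo_slice uM) (normS1x_oo_slice uhM)) => s h1 h2 s0.
by split; [apply: h1|apply: h2]; rewrite /= in_itv/= s0.
Qed.

Lemma residual_eq (mu' gamma' vt vht p ph a ah b bh res : R) :
  vt - p = mu' * a - gamma' * b + 0 -> vht - ph = mu' * ah - gamma' * bh + res ->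
  (p - ph) + (mu' * (a - ah) - gamma' * (b - bh)) - (vt - vht) = res.
Proof. lra. Qed.

(** Positive times.  The solutions are used on a time interval ending strictly
after t, so that every time up to t is interior or initial and all curves are
continuous up to t. *)
Lemma etaR_bound (gamma mu : R) W u v uh vh Res (CP : R) :
  0 < gamma -> 0 <= mu -> class_C3 W ->
  strong_solution W gamma mu (fun _ _ => 0) u v ->
  strong_solution W gamma mu Res uh vh ->
  measurableS1x `]0, +oo[ Res ->
  ae_eq leb S1 (uh 0) (u 0) ->
  (Mbar u uh < +oo)%E -> poincare_constant CP ->
  forall t : R, 0 < t ->
    (etaR gamma mu u v uh vh t <=
    (etaR gamma mu u v uh vh 0 + normS1x `]0%R, t[ 2%:E Res ^+ 2)
    * expeR (\int[leb]_(s in `[0%R, t]) K gamma CP (Wbar W u uh) uh s))%E.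
Proof.
move=> g0 mu0 W3 [ut [vt [Hu Hv Hdu Hdv]]] [uht [vht [Huh Hvh Hduh Hdvh]]] mRes u0 Mfin HCP t t0.
pose T := t + 1; have T0 : 0 < T by rewrite addr_gt0.
have tT : t <= T by rewrite lerDl.
have [uT utC] := Hu T T0; have [vT vtC] := Hv T T0.
have [uhT uhtC] := Huh T T0; have [vhT vhtC] := Hvh T T0.
have [_ utT _] := utC; have [_ uhtT _] := uhtC.
have [_ vtT _] := vtC; have [_ vhtT _] := vhtC.
have cf : L2cont T (err0 v vh) := L2contB (path_L2cont0 vT) (path_L2cont0 vhT).
have cft : L2cont T (err0 vt vht) := L2contB (path_L2cont0 vtT) (path_L2cont0 vhtT).
have cfx : L2cont T (err 1 v vh) := L2contB (path_L2cont vT (isT : (1 <= 2)%N)) (path_L2cont vhT (isT : (1 <= 2)%N)).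
have cfxx : L2cont T (err 2 v vh) := L2contB (path_L2cont vT (isT : (2 <= 2)%N)) (path_L2cont vhT (isT : (2 <= 2)%N)).
have ce : L2cont T (err0 u uh) := L2contB (path_L2cont0 uT) (path_L2cont0 uhT).
have cet : L2cont T (err0 ut uht) := L2contB (path_L2cont0 utT) (path_L2cont0 uhtT).
have cex : L2cont T (err 1 u uh) := L2contB (path_L2cont uT (isT : (1 <= 3)%N)) (path_L2cont uhT (isT : (1 <= 3)%N)).
have cexx : L2cont T (err 2 u uh) := L2contB (path_L2cont uT (isT : (2 <= 3)%N)) (path_L2cont uhT (isT : (2 <= 3)%N)).
have cexxx : L2cont T (err 3 u uh) := L2contB (path_L2cont uT (isT : (3 <= 3)%N)) (path_L2cont uhT (isT : (3 <= 3)%N)).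
have cext : L2cont T (err 1 ut uht) := L2contB (path_L2cont utT (isT : (1 <= 1)%N)) (path_L2cont uhtT (isT : (1 <= 1)%N)).
have df : L2deriv T (err0 v vh) (err0 vt vht) :=
  L2derivB (path_L2cont0 vT) (path_L2cont0 vhT) (path_L2deriv0 vtC) (path_L2deriv0 vhtC).
have de : L2deriv T (err0 u uh) (err0 ut uht) :=
  L2derivB (path_L2cont0 uT) (path_L2cont0 uhT) (path_L2deriv0 utC) (path_L2deriv0 uhtC).
have dex : L2deriv T (err 1 u uh) (err 1 ut uht) :=
  L2derivB (path_L2cont uT (isT : (1 <= 3)%N)) (path_L2cont uhT (isT : (1 <= 3)%N))
   (path_L2deriv utC (isT : (1 <= 1)%N)) (path_L2deriv uhtC (isT : (1 <= 1)%N)).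
have wf s : 0 <= s <= T -> is_wderiv 1 (err0 v vh s) (err 1 v vh s).
  by move=> sT; exact: (wderivB (path_wderiv1 vT (isT : (0 < 2)%N) sT) (path_wderiv1 vhT (isT : (0 < 2)%N) sT)).
have wfx s : 0 <= s <= T -> is_wderiv 1 (err 1 v vh s) (err 2 v vh s).
  by move=> sT; exact: (wderivB (path_wderiv vT (isT : (1 < 2)%N) sT) (path_wderiv vhT (isT : (1 < 2)%N) sT)).
have we s : 0 <= s <= T -> is_wderiv 1 (err0 u uh s) (err 1 u uh s).
  by move=> sT; exact: (wderivB (path_wderiv1 uT (isT : (0 < 3)%N) sT) (path_wderiv1 uhT (isT : (0 < 3)%N) sT)).
have wex s : 0 <= s <= T -> is_wderiv 1 (err 1 u uh s) (err 2 u uh s).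
  by move=> sT; exact: (wderivB (path_wderiv uT (isT : (1 < 3)%N) sT) (path_wderiv uhT (isT : (1 < 3)%N) sT)).
have wexx s : 0 <= s <= T -> is_wderiv 1 (err 2 u uh s) (err 3 u uh s).
  by move=> sT; exact: (wderivB (path_wderiv uT (isT : (2 < 3)%N) sT) (path_wderiv uhT (isT : (2 < 3)%N) sT)).
have wet s : 0 <= s <= T -> is_wderiv 1 (err0 ut uht s) (err 1 ut uht s).
  by move=> sT; exact: (wderivB (path_wderiv1 utT (isT : (0 < 1)%N) sT) (path_wderiv1 uhtT (isT : (0 < 1)%N) sT)).
have etE s : 0 < s -> ae_eq leb S1 (err0 ut uht s) (err 1 v vh s).
  move=> s0; apply: (ae_imp2 _ (Hdu s s0) (Hduh s s0)) => x h1 h2 Sx.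
  by rewrite /err0 /err h1// h2.
have extE s : 0 < s -> 0 <= s <= T -> ae_eq leb S1 (err 1 ut uht s) (err 2 v vh s).
  move=> s0 sT; apply: wderiv_unique (wfx s sT).
  apply: (wderiv_eq (wet s sT) _ _ (etE s s0) (ae_eq_refl _ _ _)).
  - by have [+ _] := cfx s sT; exact: L2_integrable.
  - by have [+ _] := cext s sT; exact: L2_integrable.
have e_mean s : 0 <= s <= T -> intS1 (err0 u uh s) = 0.
  apply: (mean_zero ce de).
    move=> r /andP[r0 rT]; have rI : 0 <= r <= T by rewrite !ltW.
    rewrite (ae_eq_intS1 _ _ (etE r r0)); first exact: wderiv1_int0 (wf r rI).
    - by have [+ _] := cet r rI; exact: L2_measurable.
    - by have [+ _] := cfx r rI; exact: L2_measurable.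
  by apply: (ae_imp _ u0) => x h Sx; rewrite /err0 h// subrr.
(* q is the stress difference; r is the residual as the equations express it,
   which is in L^2 at every positive time by construction. *)
pose q s := fun x => wderiv 1 (fun y => derive1 W (u s y)) x -
                     wderiv 1 (fun y => derive1 W (uh s y)) x.
pose r s := fun x => q s x + (mu * err 2 v vh s x - gamma * err 3 u uh s x) - err0 vt vht s x.
have Lq s : 0 < s -> L2 (q s).
  move=> s0; have [H1 _] := Hdv s s0; have [H2 _] := Hdvh s s0.
  by apply: L2B; [exact: (Hk_L2_wderiv H1)|exact: (Hk_L2_wderiv H2)].
have Lr s : 0 < s -> 0 <= s <= T -> L2 (r s).
  move=> s0 sT; apply: L2B; last by case: (cft s sT).
  apply: L2D; first exact: Lq.
  by apply: L2B; apply: L2Z; [case: (cfxx s sT)|case: (cexxx s sT)].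
have rE s : 0 < s -> ae_eq leb S1 (r s) (Res s).
  move=> s0; have [_ h1] := Hdv s s0; have [_ h2] := Hdvh s s0.
  apply: (ae_imp2 _ h1 h2) => x e1 e2 Sx.
  exact: (residual_eq (e1 Sx) (e2 Sx)).
have qE s : 0 < s -> 0 <= s <= T -> ae_eq leb S1 (q s)
   (fun x => derive1n 2 W (u s x) * wderiv 1 (u s) x -
             derive1n 2 W (uh s x) * wderiv 1 (uh s) x).
  move=> s0 sT; have w1 := stress_wderiv W3 uT sT; have w2 := stress_wderiv W3 uhT sT.
  have v1 := wderiv_unique (wderivP (ex_intro _ _ w1)) w1.
  have v2 := wderiv_unique (wderivP (ex_intro _ _ w2)) w2.
  by apply: (ae_imp2 _ v1 v2) => x h1 h2 Sx; rewrite /q h1// h2.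
pose N s := fine (normS1 +oo (wderiv 1 (uh s))).
pose k s := growth gamma CP (Wbar W u uh) (N s).
pose y' s := (ip (err0 v vh s) (err0 vt vht s) +
   gamma * ip (err 1 u uh s) (err 1 ut uht s)) + mu / 4 * dissipation v vh s.
pose y s := rel_energy gamma u v uh vh s + mu / 4 * prim (dissipation v vh) s.
have cc := dissipation_continuous (isT : (0 < 2)%N) vT vhT.
have sub : `[0, t] `<=` `[0, T] by apply: subset_itvl; rewrite bnd_simp.
have cty : {within `[0, t], continuous y}.
  apply: continuous_subspaceW sub _ => s; apply: cvgD.
    apply: cvgM; first exact: cvg_cst.
    apply: cvgD; first exact: (L2cont_ip cf cf).
    by apply: cvgM; [exact: cvg_cst|exact: (L2cont_ip cex cex)].
  by apply: cvgM; [exact: cvg_cst|exact: (prim_within_continuous (ltW T0) cc)].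
have cty' : {within `[0, t], continuous y'}.
  apply: continuous_subspaceW sub _ => s; apply: cvgD.
    apply: cvgD; first exact: (L2cont_ip cf cft).
    by apply: cvgM; [exact: cvg_cst|exact: (L2cont_ip cex cext)].
  by apply: cvgM; [exact: cvg_cst|exact: cc].
have ctk : {within `[0, t], continuous k}.
  by apply: continuous_subspaceW sub _; exact: growth_continuous.
have dy s : 0 < s < t -> is_derive s (1 : R) y (y' s).
  move=> /andP[s0 st]; have sT : 0 < s < T by rewrite s0 (lt_le_trans st).
  have d1 := is_derive_ip sT cf cf df df; have d2 := is_derive_ip sT cex cex dex dex.
  have d3 := is_derive_prim cc sT.
  have d4 := is_deriveD (is_deriveZ 2^-1 (is_deriveD d1 (is_deriveZ gamma d2))) (is_deriveZ (mu / 4) d3).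
  apply: (is_derive_eq d4).
  rewrite /y' /GRing.scale/= [ip (err0 vt _ _) _]ipC [ip (err 1 ut _ _) _]ipC.
  by field.
have mI : measurable (`]0, t[ : set (measurableTypeR R)) by exact: measurable_itv.
have mRt : measurableS1x `]0, t[ Res.
  apply: measurable_funS mRes.
    by apply: measurableX; exact: measurable_itv.
  by move=> [x s] [Sx /=]; rewrite !in_itv/= => /andP[-> _].
have [mrho rhoE] := normS1x_sqr mI mRt.
have bound : \forall s \ae leb, `]0, t[%classic s ->
    ((y' s - k s * y s)%:E <= normS1 2%:E (Res s) ^+ 2)%E.
  apply: (ae_imp _ (Mbar_slice Mfin)) => s + /=; rewrite in_itv/= => + /andP[s0 st].
  move=> /(_ s0)[uM uhM].
  have sT : 0 <= s <= T by rewrite !ltW// (lt_le_trans st).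
  have [Lf _] := cf s sT; have [Lft _] := cft s sT; have [Lfx _] := cfx s sT.
  have [Lfxx _] := cfxx s sT; have [Lex _] := cex s sT; have [Lext _] := cext s sT.
  have [Lexx _] := cexx s sT; have [Lexxx _] := cexxx s sT; have [Le _] := ce s sT.
  have Lqs := Lq s s0; have Lrs := Lr s s0 sT.
  have mRs : meas_S1 (Res s).
    by apply: (measurableS1x_slice mI mRt); rewrite /= in_itv/= s0.
  have LRes := ae_eq_L2 mRs (rE s s0) Lrs.
  rewrite (normS1E LRes) -(ae_eq_nrm Lrs LRes (rE s s0)) -EFinM -expr2 sqr_nrm lee_fin.
  have ftE : ae_eq leb S1 (err0 vt vht s)
      (fun x => q s x + (mu * err 2 v vh s x - gamma * err 3 u uh s x) - r s x).
    by apply: aeW => x Sx; rewrite /r; ring.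
  have rate := energy_rate Lf Lft Lfx Lfxx Lex Lext Lexx Lexxx Lqs Lrs
    (wf s sT) (wfx s sT) (wex s sT) (wexx s sT) ftE (extE s s0 sT).
  have ePo := poincare_nrm HCP (we s sT) Le Lex (e_mean s sT).
  have wuhx := path_wderiv uhT (isT : (1 < 3)%N) sT.
  have [Luhx _] := path_L2cont uhT (isT : (1 <= 3)%N) sT.
  have [Luhxx _] := path_L2cont uhT (isT : (2 <= 3)%N) sT.
  have [Lux _] := path_L2cont uT (isT : (1 <= 3)%N) sT.
  have [Lu _] := path_L2cont0 uT sT; have [Luh _] := path_L2cont0 uhT sT.
  have uhxN : \forall x \ae leb, S1 x -> `|wderiv 1 (uh s) x| <= N s.
    have := normS1_oo_ge (wderiv 1 (uh s)); rewrite (normS1_ooE wuhx Luhx Luhxx).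
    by apply: ae_imp => x h Sx; rewrite -lee_fin h.
  have N0 : 0 <= N s by rewrite fine_ge0// normS1_oo_ge0.
  have sb := stress_bound W3 Lu Luh Lux Luhx Lqs N0 uM uhM uhxN (qE s s0 sT) ePo.
  have h2 : 0 < 2^-1 :> R by rewrite invr_gt0.
  have h4 : 0 < 4^-1 :> R by rewrite invr_gt0.
  have young_q : ip (err0 v vh s) (q s) <= 2^-1 * ip (err0 v vh s) (err0 v vh s) +
      Wbar W u uh ^+ 2 * (1 + CP ^+ 2 * N s ^+ 2) * ip (err 1 u uh s) (err 1 u uh s).
    apply: (le_trans (ip_young h2 Lf Lqs)); rewrite lerD2l.
    have -> : (4 * 2^-1)^-1 = 2^-1 :> R by field.
    have -> : Wbar W u uh ^+ 2 * (1 + CP ^+ 2 * N s ^+ 2) * ip (err 1 u uh s) (err 1 u uh s) =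
      2^-1 * (2 * normC3 W (fine (Mbar u uh)) ^+ 2 * (1 + CP ^+ 2 * N s ^+ 2) *
         ip (err 1 u uh s) (err 1 u uh s)) by rewrite /Wbar; field.
    by rewrite ler_pM2l.
  have young_r : - ip (err0 v vh s) (r s) <= 4^-1 * ip (err0 v vh s) (err0 v vh s) +
      ip (r s) (r s).
    have LN := L2Z (-1) Lrs; have := ip_young h4 Lf LN.
    rewrite !ipZr// !ipZl// !mulN1r opprK.
    have -> : (4 * 4^-1)^-1 = 1 :> R by field.
    by rewrite mul1r.
  apply: (rate_bound g0 mu0 _ _ _ _ young_q young_r rate).
  - exact: ip_ge0.
  - exact: ip_ge0.
  - exact: ip_ge0.
  - by apply: Rintegral_ge0 => z _; exact: ip_ge0.
have rho0 s : (0 <= normS1 2%:E (Res s) ^+ 2)%E by apply: expe_ge0; exact: Lnorm_ge0.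
have := gronwall t0 cty cty' ctk (fun s => growth_ge0 _ _ _ _) dy mrho rho0 bound.
have t0T : 0 <= t <= T by rewrite (ltW t0).
have z0T : 0 <= (0 : R) <= T by rewrite lexx (ltW T0).
rewrite rhoE (etaRE gamma mu t0T uT uhT vT vhT) (etaRE gamma mu z0T uT uhT vT vhT).
rewrite (_ : (\int[leb]_(s in `[0%R, t]) K gamma CP (Wbar W u uh) uh s)%E =
             (\int[leb]_(s in `[0%R, t]) (k s)%:E)%E)//.
apply: eq_integral => s /set_mem; rewrite /= in_itv/= => /andP[s0 st].
by apply: (KE _ _ _ _ uhT); rewrite s0 (le_trans st).
Qed.

End entropy_bound.

Local Open Scope ereal_scope.

Theorem theorem3p3 (R : realType) (gamma mu : R) (W : R -> R)
    (u v uh vh Res : R -> R -> R) (CP : R)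
    (gamma_gt0 : (0 < gamma)%R) (mu_ge0 : (0 <= mu)%R)
    (W_C3 : class_C3 W) (W_ge0 : forall x, (0 <= W x)%R)
    (sol : strong_solution W gamma mu (fun _ _ => 0%R) u v)
    (solh : strong_solution W gamma mu Res uh vh)
    (u_meas : measurableS1x `]0%R, +oo[ u)
    (uh_meas : measurableS1x `]0%R, +oo[ uh)
    (Res_meas : measurableS1x `]0%R, +oo[ Res)
    (u_init : ae_eq leb S1 (uh 0%R) (u 0%R))
    (v_init : ae_eq leb S1 (vh 0%R) (v 0%R))
    (Mbar_fin : Mbar u uh < +oo)
    (CP_poincare : poincare_constant CP) :
  forall t : R, (0 <= t)%R ->
    etaR gamma mu u v uh vh t <=
    (etaR gamma mu u v uh vh 0%R + normS1x `]0%R, t[ 2%:E Res ^+ 2)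
    * expeR (\int[leb]_(s in `[0%R, t]) K gamma CP (Wbar W u uh) uh s).
Proof.
(* At t = 0 the bound holds because K >= 0 makes the exponential at least 1. *)
move=> t; rewrite le_eqVlt => /predU1P[<-|t0]; last exact: etaR_bound Mbar_fin CP_poincare t t0.
have e0 := etaR_ge0 0%R u v uh vh (ltW gamma_gt0) mu_ge0.
have n0 : 0 <= normS1x `]0%R, 0%R[ 2%:E Res ^+ 2 by apply: expe_ge0; exact: Lnorm_ge0.
rewrite -[leLHS]mule1; apply: lee_pmul => //; first by rewrite leeDl.
rewrite -expeR0 lee_expeR; apply: integral_ge0 => s _.
by rewrite /K le_max; apply/orP; right; rewrite lee_fin divr_ge0.
Qed.
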